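(* For every $r\ge 2$, the language $\mathrm{PP}_r$ is not a well-nested multiple context-free language.
   Context: Let $F_r=F(x_1,\dots,x_r)$ be the free group of rank $r$. Words are reduced words over the alphabet $\Sigma=\{x_1,x_1^{-1},\dots,x_r,x_r^{-1}\}$. A word is cyclically reduced if it is reduced and its first and last letters are not inverse to each other. A word is positive if it is a product of the generators without inverses; it is potentially positive if some automorphism of $F_r$ maps it to a positive word. $\mathrm{PP}_r\subseteq\Sigma^*$ is the set of cyclically reduced potentially positive words in $F_r$. A multiple context-free grammar over $\Sigma$ has a finite set of nonterminals, each nonterminal $A$ having a dimension $d(A)\ge1$, a start symbol $S$ with $d(S)=1$, and finitely many rules of the form $A(t_1,\dots,t_q)\leftarrow B_1(x_{1,1},\dots,x_{1,q_1}),\dots,B_m(x_{m,1},\dots,x_{m,q_m})$ with $m\ge 0$, $q=d(A)$, $q_i=d(B_i)$, the $x_{i,j}$ pairwise distinct variables, and $t_1,\dots,t_q$ strings over $\Sigma\cup\{x_{i,j}\}$ in which each variable occurs at most once in total. The derivable facts are the smallest set such that, for each rule, if $B_i(u_{i,1},\dots,u_{i,q_i})$ (with $u_{i,j}\in\Sigma^*$) is derivable for every $i$, then so is the fact obtained from $A(t_1,\dots,t_q)$ by substituting $u_{i,j}$ for $x_{i,j}$. The language of the grammar is $\{w\in\Sigma^*: S(w)\text{ is derivable}\}$. The grammar is well-nested if in every rule (i) every variable $x_{i,j}$ occurs exactly once in $t_1\cdots t_q$; (ii) for each $i$ the variables $x_{i,1},\dots,x_{i,q_i}$ occur in this order in $t_1\cdots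 t_q$; (iii) there are no $i\ne i'$, $j<q_i$, $j'<q_{i'}$ such that $x_{i,j},x_{i',j'},x_{i,j+1},x_{i',j'+1}$ occur in this order in $t_1\cdots t_q$. A well-nested multiple context-free language is the language of a well-nested multiple context-free grammar. *)

(* Defs.v *)
From HB Require Import structures.
From mathcomp Require Import all_boot.

Set Implicit Arguments.
Unset Strict Implicit.
Unset Printing Implicit Defensive.

(* The letter (x, false) stands for the generator x, (x, true) for x^-1. *)
Definition letter (X : Type) : Type := (X * bool)%type.

Definition linv (X : Type) (a : letter X) : letter X := (a.1, ~~ a.2).

Lemma linvK (X : Type) : involutive (@linv X).
Proof. by case=> x b; rewrite /linv /= negbK. Qed.

Section FreeGroup.

Variable X : choiceType.
Implicit Types (a b : letter X) (u v w : seq (letter X)).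

Definition reduced w : bool := sorted (fun a b => b != linv a) w.

Definition push a w : seq (letter X) :=
  if w is b :: w' then if b == linv a then w' else a :: w else [:: a].

Definition reduce w : seq (letter X) := foldr push [::] w.

Lemma push_reduced a w : reduced w -> reduced (push a w).
Proof.
case: w => [|b w] //= rw; case: ifP => [_|ab]; first exact: path_sorted rw.
by rewrite /reduced /= ab.
Qed.

Lemma reduce_reduced w : reduced (reduce w).
Proof. by elim: w => //= a w; apply: push_reduced. Qed.

Lemma pushK a w : reduced w -> push (linv a) (push a w) = w.
Proof.
case: w => [|b w] /=; first by rewrite linvK eqxx.
case: ifP => [/eqP-> | _ _] /=; last by rewrite linvK eqxx.
by case: w => [|c w] //= /andP[/negPf-> _].
Qed.

Lemma pushVK a w : reduced w -> push a (push (linv a) w) = w.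
Proof. by rewrite -{1}[a]linvK; apply: pushK. Qed.

Lemma reduce_id w : reduced w -> reduce w = w.
Proof.
elim: w => //= a w IHw raw; rewrite IHw; last exact: path_sorted raw.
by case: w raw {IHw} => //= b w /andP[/negPf-> _].
Qed.

Lemma foldr_push_reduced u v : reduced v -> reduced (foldr push v u).
Proof. by move=> rv; elim: u => //= a u; apply: push_reduced. Qed.

Lemma foldr_push_push a u v :
  reduced v -> foldr push v (push a u) = push a (foldr push v u).
Proof.
move=> rv; case: u => //= b u; case: ifP => //= /eqP->.
by rewrite pushVK // foldr_push_reduced.
Qed.

Lemma foldr_push_reduce u v :
  reduced v -> foldr push v (reduce u) = foldr push v u.
Proof. by move=> rv; elim: u => //= a u IHu; rewrite foldr_push_push // IHu. Qed.

Lemma reduce_cat u v : reduce (u ++ v) = foldr push (reduce v) u.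
Proof. by rewrite /reduce foldr_cat. Qed.

Lemma reduce_catr u v : reduce (u ++ reduce v) = reduce (u ++ v).
Proof. by rewrite !reduce_cat (reduce_id (reduce_reduced v)). Qed.

Lemma reduce_catl u v : reduce (reduce u ++ v) = reduce (u ++ v).
Proof. by rewrite !reduce_cat foldr_push_reduce ?reduce_reduced. Qed.

Definition winv w : seq (letter X) := rev (map (@linv X) w).

Lemma winvK : involutive winv.
Proof.
move=> w; rewrite /winv map_rev revK -map_comp -[RHS]map_id.
by apply: eq_map => a /=; rewrite linvK.
Qed.

Lemma winv_reduced w : reduced w -> reduced (winv w).
Proof.
rewrite /reduced /winv rev_sorted sorted_map; apply: sub_sorted => a b /=.
by apply: contraNneq => /(can_inj (@linvK X)) ->; rewrite linvK.
Qed.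

Lemma reduce_winvl w : reduce (winv w ++ w) = [::].
Proof.
elim: w => // a w IHw; rewrite /winv /= rev_cons cat_rcons !reduce_cat /=.
by rewrite pushK ?reduce_reduced // -reduce_cat.
Qed.

(* The free group on X: reduced words, multiplied by concatenating and then
   freely reducing. *)
Record freegroup := FreeGroup { fgword :> seq (letter X); _ : reduced fgword }.

HB.instance Definition _ := [isSub for fgword].
HB.instance Definition _ := [Choice of freegroup by <:].

Implicit Types x y z : freegroup.

Definition fgclass w : freegroup := FreeGroup (reduce_reduced w).
Definition fg_mul x y : freegroup := fgclass (x ++ y).
Definition fg_one : freegroup := @FreeGroup [::] isT.
Definition fg_inv x : freegroup := FreeGroup (winv_reduced (valP x)).

Fact fg_mulA : associative fg_mul.
Proof.
by move=> x y z; apply: val_inj; rewrite /= reduce_catr reduce_catl catA.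
Qed.

Fact fg_mul1g : left_id fg_one fg_mul.
Proof. by move=> x; apply/val_inj/reduce_id/valP. Qed.

Fact fg_mulg1 : right_id fg_one fg_mul.
Proof. by move=> x; apply: val_inj; rewrite /= cats0 reduce_id //; case: x. Qed.

Fact fg_mulVg : left_inverse fg_one fg_inv fg_mul.
Proof. by move=> x; apply/val_inj/reduce_winvl. Qed.

Fact fg_mulgV : right_inverse fg_one fg_inv fg_mul.
Proof.
by move=> x; apply: val_inj; rewrite /= -{1}[fgword x]winvK reduce_winvl.
Qed.

HB.instance Definition _ :=
  isGroup.Build freegroup fg_mulA fg_mul1g fg_mulg1 fg_mulVg fg_mulgV.

Definition cyclically_reduced w : bool :=
  reduced w && (if w is a :: w' then last a w' != linv a else true).

Definition positive w : bool := all (fun a => ~~ a.2) w.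

Definition potentially_positive x : Prop :=
  exists2 phi : {multiplicative freegroup -> freegroup},
    bijective phi & positive (phi x).

End FreeGroup.

Definition language (Sigma : Type) := seq Sigma -> Prop.

Definition PP (r : nat) : language (letter 'I_r) :=
  fun w => cyclically_reduced w /\ potentially_positive (fgclass w).

Arguments PP r w : clear implicits.

Section MCFG.

Variable Sigma : Type.

(* A rule  lhs(t_1, ..., t_q) <- rhs_1(x_11, ...), ..., rhs_m(x_m1, ...).
   Indices start at 0; the variable x_ij is the pair Tagged _ j, with tag i. *)
Record rule (N : Type) (d : N -> nat) := Rule {
  lhs : N;
  arity : nat;
  rhs : 'I_arity -> N;
  tmpl : (d lhs).-tuple (seq (Sigma + {i : 'I_arity & 'I_(d (rhs i))}))
}.

Section Rules.

Variables (N : Type) (d : N -> nat).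
Implicit Type rho : rule d.

Definition var rho : eqType := {i : 'I_(arity rho) & 'I_(d (rhs i))}.

Definition mkvar rho (i : 'I_(arity rho)) (j : 'I_(d (rhs i))) : var rho :=
  Tagged (fun i => 'I_(d (rhs i))) j.

Definition var_occs rho : seq (var rho) :=
  pmap (fun c => if c is inr v then Some v else None) (flatten (tmpl rho)).

Definition subst rho
    (u : forall i : 'I_(arity rho), (d (rhs i)).-tuple (seq Sigma))
    (t : seq (Sigma + var rho)) : seq Sigma :=
  flatten [seq match c with
               | inl a => [:: a]
               | inr v => tnth (u (tag v)) (tagged v)
               end | c <- t].

Definition linear_rule rho : Prop :=
  forall v : var rho, count_mem v (var_occs rho) <= 1.

Definition precedes rho (v v' : var rho) : bool :=
  index v (var_occs rho) < index v' (var_occs rho).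

(* [precedes] is only meaningful for variables that do occur, which the first
   clause guarantees. *)
Definition well_nested_rule rho : Prop :=
  [/\ forall v : var rho, count_mem v (var_occs rho) = 1,
      forall (i : 'I_(arity rho)) (j k : 'I_(d (rhs i))),
        j < k -> precedes (mkvar j) (mkvar k)
    & forall (i i' : 'I_(arity rho)) (j k : 'I_(d (rhs i)))
             (j' k' : 'I_(d (rhs i'))),
        i != i' -> k = j.+1 :> nat -> k' = j'.+1 :> nat ->
        ~ [/\ precedes (mkvar j) (mkvar j'),
              precedes (mkvar j') (mkvar k)
            & precedes (mkvar k) (mkvar k')]].

End Rules.

Record mcfg := MCFG {
  nonterm : finType;
  dim : nonterm -> nat;
  start : nonterm;
  rule_index : finType;
  rules : rule_index -> rule dim;
  dim_gt0 : forall A, 0 < dim A;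
  dim_start : dim start = 1;
  rules_linear : forall k, linear_rule (rules k)
}.

Inductive derivable (G : mcfg) :
    forall A : nonterm G, (dim A).-tuple (seq Sigma) -> Prop :=
  | Derivable (k : rule_index G)
      (u : forall i : 'I_(arity (rules k)), (dim (rhs i)).-tuple (seq Sigma)) :
      (forall i, derivable (u i)) ->
      derivable (map_tuple (subst u) (tmpl (rules k))).

Definition mcfg_lang (G : mcfg) : language Sigma :=
  fun w => exists2 t : (dim (start G)).-tuple (seq Sigma),
    t = [:: w] :> seq (seq Sigma) & derivable t.

Definition well_nested (G : mcfg) : Prop :=
  forall k : rule_index G, well_nested_rule (rules k).

Definition well_nested_mcfl (L : language Sigma) : Prop :=
  exists2 G : mcfg, well_nested G & forall w, L w <-> mcfg_lang G w.

End MCFG.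

(* Main.v *)
From HB Require Import structures.
From mathcomp Require Import all_boot all_order all_algebra zify.
From Stdlib Require Import Classical_Prop Classical_Pred_Type.
Require Import Defs.

(* Consider the words W = a^15 prod_i (b a^-n_i b a^15 b^-1 a^m_i b^-1 a^15).
   If n_i = m_i = n for all i, then W becomes positive under b |-> b a^n
   followed by a |-> a b^2.  Conversely, an automorphism phi that makes W
   positive forces n_i < m_j + 13 for all i and j: in the Cayley tree, project
   to the axis of phi(a).  A conjugate of phi(W) is positive, so the geodesic
   that it labels follows the translates of this axis only in the positive
   direction, and each factor b a^-n_i b, resp. b^-1 a^m_j b^-1, bounds the
   distance of the projections of phi(b) and phi(b)^-1 from one side.

   Suppose a grammar generates all of these potentially positive words, and
   only potentially positive ones.  Label the facts of a derivation by their
   nonterminal and by the transitions that their strings induce on an automaton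
   for the shape of W with a number K of factors; a repeated label can be
   pumped without leaving the shape.  A pump contributes no letter b or b^-1,
   hence, for K large with respect to the dimensions, leaves some m_j bounded.
   So it contributes no a^-1 either, since otherwise some n_i would grow beyond
   m_j + 13, and removing it preserves the number of letters a^-1.  Therefore
   this number is bounded on the words of the grammar of this shape, which fails
   for n_i = m_i = n large. *)

Set Implicit Arguments.
Unset Strict Implicit.
Unset Printing Implicit Defensive.

Import GRing.Theory Num.Theory Order.TTheory.

(** * Length, distance and degree in the free group *)

Section WordMetric.

Variable X : choiceType.
Implicit Types (a b : letter X) (u v w : seq (letter X)) (x y z t : freegroup X).

Lemma fgclass_cat u v : fgclass (u ++ v) = (fgclass u * fgclass v)%g.
Proof. by apply: val_inj; rewrite /= reduce_catl reduce_catr. Qed.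

Lemma fgclass_val x : fgclass x = x.
Proof. by apply/val_inj/reduce_id/valP. Qed.

Lemma fgclass_nil : fgclass [::] = 1%g :> freegroup X.
Proof. exact: val_inj. Qed.

Lemma fgclass_cons a u : fgclass (a :: u) = (fgclass [:: a] * fgclass u)%g.
Proof. exact: (fgclass_cat [:: a]). Qed.

Lemma fgclass_winv u : fgclass (winv u) = (fgclass u)^-1%g.
Proof.
apply/eqP; rewrite -mulg_eq1 -fgclass_cat; apply/eqP/val_inj.
by rewrite /= reduce_winvl.
Qed.

Lemma reduced_cat u v :
  reduced (u ++ v) =
  [&& reduced u, reduced v &
      if v is b :: _ then if u is a :: u' then b != linv (last a u') else true
      else true].
Proof.
case: u => [|a u] /=; first by case: v => [|b v]; rewrite ?andbT.
rewrite /reduced /= cat_path; case: v => [|b v] /=; first by rewrite !andbT.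
by rewrite [X in _ && X]andbC.
Qed.

(** For reduced words this is the Gromov product at the identity; its ultrametric inequality
    [lcp_ultra] is what makes the Cayley graph 0-hyperbolic. *)
Fixpoint lcp u v : nat :=
  match u, v with
  | a :: u', b :: v' => if a == b then (lcp u' v').+1 else 0
  | _, _ => 0
  end.

Lemma lcpC u v : lcp u v = lcp v u.
Proof. by elim: u v => [|a u IHu] [|b v] //=; rewrite eq_sym IHu. Qed.

Lemma lcp_ultra u v w : minn (lcp u v) (lcp v w) <= lcp u w.
Proof.
elim: u v w => [|a u IHu] [|b v] [|c w] //=; rewrite ?min0n ?minn0 //.
have [->|_] := eqVneq a b; last by rewrite min0n.
case: eqVneq => [_|_]; last by rewrite minn0.
by rewrite minnSS ltnS.
Qed.

Definition len x : nat := size x.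
Definition dist x y : nat := len (x^-1 * y)%g.

(** In [winv u ++ v] exactly the common prefix cancels: once the first letters differ, the
    concatenation is reduced. *)
Lemma size_reduce_lcp u v : reduced u -> reduced v ->
  size (reduce (winv u ++ v)) + (lcp u v).*2 = size u + size v.
Proof.
elim: u v => [|a u IHu] v ru rv.
  by case: v rv => [|b v] rv; rewrite reduce_id // /winv /= addn0.
have rw := winv_reduced ru.
case: v rv => [|b v] rv; first by rewrite cats0 reduce_id // size_rev size_map.
rewrite [lcp _ _]/=; case: (eqVneq a b) => [eab|nab].
  have -> : reduce (winv (a :: u) ++ b :: v) = reduce (winv u ++ v).
    rewrite {}eab /winv map_cons rev_cons cat_rcons !reduce_cat /=.
    by rewrite pushK ?reduce_reduced.
  by rewrite doubleS !addnS (IHu v (path_sorted ru) (path_sorted rv)) addSn.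
rewrite reduce_id ?addn0; first by rewrite size_cat /winv size_rev size_map.
rewrite reduced_cat rw rv /=; move: rw.
rewrite /winv /= rev_cons.
case: (rev _) => [|c s] _ /=; first by rewrite linvK eq_sym.
by rewrite last_rcons linvK eq_sym.
Qed.

Lemma dist_lcp x y : dist x y + (lcp x y).*2 = len x + len y.
Proof. exact: (size_reduce_lcp (valP x) (valP y)). Qed.

Lemma len1 : len 1%g = 0. Proof. by []. Qed.

Lemma len_eq0 x : len x = 0 -> x = 1%g.
Proof. by move=> /size0nil e; apply: val_inj. Qed.

Lemma lenV x : len x^-1%g = len x.
Proof. by rewrite /len /= /winv size_rev size_map. Qed.

Lemma distC x y : dist x y = dist y x.
Proof. by rewrite /dist -lenV invgM invgK. Qed.

Lemma dist_mull g x y : dist (g * x)%g (g * y)%g = dist x y.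
Proof. by rewrite /dist invgM -mulgA mulKg. Qed.

Lemma dist1l x : dist 1%g x = len x.
Proof. by rewrite /dist invg1 mul1g. Qed.

Lemma dist1r x : dist x 1%g = len x.
Proof. by rewrite distC dist1l. Qed.

Lemma distxx x : dist x x = 0.
Proof. by rewrite /dist mulVg. Qed.

Lemma dist_eq0 x y : dist x y = 0 -> x = y.
Proof. by move=> /len_eq0 /mulg1_eq; rewrite invgK. Qed.

(* The Cayley graph of a free group is a tree, i.e. 0-hyperbolic. *)
Lemma four_point x y z t :
  dist x y + dist z t <= maxn (dist x z + dist y t) (dist x t + dist y z).
Proof.
(* Translating [t] to the identity turns distances from [t] into lengths; [dist_lcp] then reduces
   the claim to [lcp_ultra]. *)
rewrite -(dist_mull t^-1%g x) -(dist_mull t^-1%g z) -(dist_mull t^-1%g x z).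
rewrite -(dist_mull t^-1%g y t) -(dist_mull t^-1%g x t) -(dist_mull t^-1%g y z).
rewrite mulVg !dist1r.
move: (_ * x)%g (_ * y)%g (_ * z)%g => {}x {}y {}z.
have := dist_lcp x y; have := dist_lcp x z; have := dist_lcp y z.
by have := lcp_ultra x z y; rewrite (lcpC z y); lia.
Qed.

Lemma dist_triangle x y z : dist x z <= dist x y + dist y z.
Proof. by have := four_point x z y y; rewrite distxx (distC z y) maxnn addn0. Qed.

Lemma lenM x y : len (x * y)%g <= len x + len y.
Proof.
by have := dist_triangle 1%g x (x * y)%g; rewrite !dist1l /dist mulKg.
Qed.

End WordMetric.

(** * Exponent sum and positivity *)

Section Degree.

Variable X : choiceType.
Implicit Types (a b : letter X) (u v w : seq (letter X)) (x y z t : freegroup X).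
Local Open Scope ring_scope.

Definition sgl a : int := if a.2 then -1 else 1.
Definition wdeg w : int := \sum_(a <- w) sgl a.
(** The homomorphism to the integers that sends every generator to 1, hence invariant under
    conjugation. Positivity enters the geometric argument as equality of [deg] and [len]. *)
Definition deg x : int := wdeg x.

Lemma wdeg_cons a w : wdeg (a :: w) = sgl a + wdeg w.
Proof. exact: big_cons. Qed.

Lemma wdeg_cat u v : wdeg (u ++ v) = wdeg u + wdeg v.
Proof. exact: big_cat. Qed.

Lemma wdeg_push a w : wdeg (push a w) = sgl a + wdeg w.
Proof.
case: w => [|b w] /=; first by rewrite wdeg_cons.
case: eqP => [->|_]; rewrite !wdeg_cons //.
by rewrite /sgl /=; case: (a.2) => /=; lia.
Qed.

Lemma wdeg_reduce w : wdeg (reduce w) = wdeg w.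
Proof. by elim: w => //= a w IHw; rewrite wdeg_push wdeg_cons IHw. Qed.

Lemma degM x y : deg (x * y)%g = deg x + deg y.
Proof. by rewrite /deg /= wdeg_reduce wdeg_cat. Qed.

Lemma deg1 : deg 1%g = 0.
Proof. by rewrite /deg /wdeg big_nil. Qed.

Lemma degV x : deg x^-1%g = - deg x.
Proof. by have := degM x x^-1%g; rewrite mulgV deg1; lia. Qed.

Lemma deg_le_len x : deg x <= (len x)%:Z.
Proof.
rewrite /deg /len; elim: (fgword x) => [|a w IHw] /=; first by rewrite /wdeg big_nil.
by rewrite wdeg_cons /sgl; case: ifP; lia.
Qed.

Lemma positive_deg x : positive x -> deg x = (len x)%:Z.
Proof.
rewrite /deg /len; elim: (fgword x) => [|a w IHw] /=; first by rewrite /wdeg big_nil.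
by case/andP=> /negPf na /IHw; rewrite wdeg_cons /sgl na; lia.
Qed.

End Degree.

(** * Projection to an axis *)

Section Axis.

Variable X : choiceType.
Implicit Types (x y z t g C B : freegroup X) (al : int -> freegroup X) (ell : nat).
Local Open Scope ring_scope.

(** The points [al m] are spaced by [ell] on a geodesic line, along which [al] acts by translations.
    Integer exponents allow the axis to be reversed. *)
Definition is_axis al ell : Prop :=
  [/\ forall m n, al (m + n) = (al m * al n)%g,
      forall m, len (al m) = (`|m| * ell)%N & (0 < ell)%N].

Definition rev_axis al : int -> freegroup X := fun m => al (- m).

Lemma is_axis_rev al ell : is_axis al ell -> is_axis (rev_axis al) ell.
Proof.
by case=> D l e; split=> // [m n|m]; rewrite /rev_axis ?opprD ?D // l abszN.
Qed.

(* The Busemann function of the end of the axis at +oo: dist g (al n) - n * ell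
   is constant once n > len g. *)
Definition busemann al ell g : int :=
  (dist g (al (len g).+1))%:Z - (len g).+1%:Z * ell%:Z.

(* Twice the coordinate of the projection of g to the axis. *)
Definition proj al ell g : int := busemann (rev_axis al) ell g - busemann al ell g.

Lemma proj_rev al ell g : proj (rev_axis al) ell g = - proj al ell g.
Proof.
suff e : busemann (rev_axis (rev_axis al)) ell g = busemann al ell g.
  by rewrite /proj e; lia.
by rewrite /busemann /rev_axis opprK.
Qed.

(* The translate of the axis by C is another axis. *)
Definition off_axis al C : Prop :=
  forall s : int, `|s|%N = 1%N -> (C * al s * C^-1)%g <> al 1.

Section Busemann.

Variables (al : int -> freegroup X) (ell : nat).
Hypothesis axP : is_axis al ell.
Let ell_gt0 : (0 < ell)%N. Proof. by case: axP. Qed.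
Local Notation ep := (busemann al ell).
Local Notation en := (busemann (rev_axis al) ell).
Local Notation pr := (proj al ell).

Lemma axisD m n : al (m + n) = (al m * al n)%g. Proof. by case: axP. Qed.

Lemma axis0 : al 0 = 1%g.
Proof. by apply/(@mulgI _ (al 0)); rewrite -axisD mulg1. Qed.

Lemma axisN m : al (- m) = (al m)^-1%g.
Proof. by apply/esym/mulg1_eq; rewrite -axisD subrr axis0. Qed.

Lemma dist_axis m n : dist (al m) (al n) = (`|(n - m)%R| * ell)%N.
Proof.
by case: axP => _ l _; rewrite /dist -axisN -axisD l addrC.
Qed.

(** When [n > len g], the geodesic from [g] to [al n.+1] passes through [al n], by the four-point
    condition with [al 0]. From there on the distance grows by [ell] at each step. *)
Lemma busemann_dist g (n : nat) : (len g < n)%N ->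
  (dist g (al n))%:Z = n%:Z * ell%:Z + ep g.
Proof.
elim: n => // n IHn; rewrite ltnS leq_eqVlt => /predU1P[<-|ltn].
  by rewrite /busemann; lia.
have {}IHn := IHn ltn.
have lte : (len g < n * ell)%N by apply: leq_trans ltn _; rewrite leq_pmulr.
have := four_point g (al n) (al 0) (al n.+1).
have := dist_triangle g (al n) (al n.+1).
have := dist_triangle (al 0) g (al n).
rewrite !dist_axis axis0 dist1l dist1r.
have -> : `|(n.+1%:Z - 0)%R|%N = n.+1 by lia.
have -> : `|(0 - n%:Z)%R|%N = n by lia.
have -> : `|(n%:Z - 0)%R|%N = n by lia.
have -> : `|(n.+1%:Z - n%:Z)%R|%N = 1%N by lia.
rewrite mulSn; lia.
Qed.

End Busemann.

Lemma busemann_shift al ell i g : is_axis al ell ->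
  busemann al ell (al i * g)%g = busemann al ell g - i * ell%:Z.
Proof.
move=> axP; pose n := (len g + len (al i * g)%g + `|i| + `|i| + 1)%N.
have lt1 : (len (al i * g)%g < n)%N by rewrite /n; lia.
have lt2 : (len g < `|(n%:Z - i)%R|)%N by rewrite /n; lia.
have := busemann_dist axP lt1; have := busemann_dist axP lt2.
have -> : `|(n%:Z - i)%R|%N%:Z = n%:Z - i by rewrite /n; lia.
have := dist_mull (al i) g (al (n%:Z - i)).
rewrite -(axisD axP); have -> : i + (n%:Z - i) = n%:Z by lia.
by move=> ->; lia.
Qed.

Lemma busemann1 al ell : is_axis al ell -> busemann al ell 1%g = 0.
Proof.
move=> axP; rewrite /busemann len1 -(axis0 axP) (dist_axis axP); lia.
Qed.

Lemma busemann_axis al ell m : is_axis al ell -> busemann al ell (al m) = - m * ell%:Z.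
Proof. by move=> axP; rewrite -[al m]mulg1 busemann_shift // busemann1 //; lia. Qed.

Section Projection.

Variables (al : int -> freegroup X) (ell : nat).
Hypothesis axP : is_axis al ell.
Let raxP := is_axis_rev axP.
Let ell_gt0 : (0 < ell)%N. Proof. by case: axP. Qed.
Local Notation ep := (busemann al ell).
Local Notation en := (busemann (rev_axis al) ell).
Local Notation pr := (proj al ell).

Lemma proj_shift i g : pr (al i * g)%g = pr g + 2 * i * ell%:Z.
Proof.
rewrite /proj busemann_shift //; have := busemann_shift (- i) g raxP.
rewrite /rev_axis opprK => ->; lia.
Qed.

Lemma proj1g : pr 1%g = 0.
Proof. by rewrite /proj !busemann1. Qed.

Lemma proj_axis m : pr (al m) = 2 * m * ell%:Z.
Proof. by rewrite -[al m]mulg1 proj_shift proj1g; lia. Qed.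

Lemma busemann_rev_axis m : en (al m) = m * ell%:Z.
Proof. by have := proj_axis m; rewrite /proj (busemann_axis m axP); lia. Qed.

(** The geodesic from [x] to [y] follows the axis between the two projections, by the four-point
    condition with the far points [al n] and [al (- n)]. *)
Lemma dist_proj x y : pr x < pr y -> (dist x y)%:Z = ep x + en y.
Proof.
rewrite /proj => ltxy; pose n := (len x + len y + 1)%N.
have ltx : (len x < n)%N by rewrite /n; lia.
have lty : (len y < n)%N by rewrite /n; lia.
have hx := busemann_dist axP ltx.
have hy := busemann_dist axP lty.
have : (dist x (al (- n%:Z)))%:Z = n%:Z * ell%:Z + en x.
  exact: (busemann_dist raxP ltx).
have : (dist y (al (- n%:Z)))%:Z = n%:Z * ell%:Z + en y.
  exact: (busemann_dist raxP lty).
have := four_point x y (al n) (al (- n%:Z)).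
have := four_point x (al n) y (al (- n%:Z)).
rewrite !(dist_axis axP) (distC (al n) y).
have -> : `|(- n%:Z - n%:Z)%R|%N = (n + n)%N by lia.
rewrite mulnDl; lia.
Qed.

Lemma dist_through x y (m : int) : pr x < 2 * m * ell%:Z -> 2 * m * ell%:Z < pr y ->
  dist x y = (dist x (al m) + dist (al m) y)%N.
Proof.
move=> ltx lty; have h := dist_proj (lt_trans ltx lty).
rewrite -(proj_axis m) in ltx lty.
have h1 := dist_proj ltx; have h2 := dist_proj lty.
have := busemann_axis m axP; have := busemann_rev_axis m; lia.
Qed.

Lemma dist_through_period x y (m : int) :
  pr x < 2 * m * ell%:Z -> 2 * (m + 1) * ell%:Z < pr y ->
  dist x y = (dist x (al m) + ell + dist (al (m + 1)) y)%N.
Proof.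
move=> ltx lty.
have lt1 : 2 * m * ell%:Z < pr y by apply: lt_trans lty; lia.
have lt2 : pr (al m) < 2 * (m + 1) * ell%:Z by rewrite proj_axis; lia.
rewrite (dist_through ltx lt1) (dist_through lt2 lty) (dist_axis axP).
have -> : `|(m + 1 - m)%R|%N = 1%N by lia.
by rewrite mul1n; lia.
Qed.

(** Consecutive points of the axis differ by [2 * ell] in the doubled coordinate, so a gap larger
    than [4 * ell] contains a whole period. *)
Lemma between_multiples (u v : int) : u + 4 * ell%:Z < v ->
  exists2 m : int, u < 2 * m * ell%:Z & 2 * (m + 1) * ell%:Z < v.
Proof.
move=> ltuv; pose m := ((u %/ (2 * ell%:Z))%Z + 1)%R.
have e2 : 2 * ell%:Z != 0 :> int by lia.
have := divz_eq u (2 * ell%:Z); have := ltz_mod u e2; have := modz_ge0 u e2.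
by move=> h1 h2 h3; exists m; rewrite /m; lia.
Qed.

End Projection.

End Axis.

(** * Translates of an axis *)

Section OffAxis.

Variable X : choiceType.
Implicit Types (x y z t g C B : freegroup X).
Local Open Scope ring_scope.

Section TranslatedAxis.

Variables (al : int -> freegroup X) (ell : nat).
Hypothesis axP : is_axis al ell.
Let raxP := is_axis_rev axP.
Let ell_gt0 : (0 < ell)%N. Proof. by case: axP. Qed.
Local Notation ep := (busemann al ell).
Local Notation en := (busemann (rev_axis al) ell).
Local Notation pr := (proj al ell).

Lemma off_axisV C : off_axis al C -> off_axis al C^-1%g.
Proof.
move=> offC s s1; rewrite invgK => e.
have {}e : al s = (C * al 1 * C^-1)%g by rewrite -e !mulgA mulgV mul1g mulgK.
have [es|es] : s = 1 \/ s = - 1 by lia.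
  by apply: (offC 1); rewrite // -e es.
apply: (offC (- 1)) => //; transitivity (C * al 1 * C^-1)^-1%g.
  by rewrite (axisN axP) !invgM invgK mulgA.
by rewrite -e es (axisN axP) invgK.
Qed.

(* A segment of the axis of length ell that lies on its translate by C is
   moved one period along by a conjugate of al 1 or of its inverse, which
   therefore is al 1. *)
Lemma proj_off_lt C i j : off_axis al C ->
  pr (C * al j)%g <= pr (C * al i)%g + 4 * ell%:Z.
Proof.
move=> offC; rewrite leNgt; apply/negP => /(between_multiples axP)[m ltm gtm].
have nij : i != j by apply: contraTneq ltm => e; move: gtm; rewrite e; lia.
(* The sign for which the step from [C * al i] to [C * al (i + s)] leads towards [C * al j]. *)
pose s : int := if i < j then 1 else - 1.
apply: (offC s); first by rewrite /s; case: ifP.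
pose T : freegroup X := (C * al s * C^-1)%g.
suff e : (T * al m)%g = al (m + 1).
  by apply/(@mulIg _ (al m)); rewrite -(axisD axP) [1 + m]addrC.
have eT k : (T * (C * al k))%g = (C * al (k + s))%g.
  by rewrite /T !mulgA mulgVK -mulgA -(axisD axP) addrC.
apply: dist_eq0.
(* The geodesic from [C * al i] to [C * al j] contains the period from [al m] to [al (m + 1)], and
   [T] shifts it by [ell] along the translated axis. The four-point condition then identifies
   [T * al m] with [al (m + 1)]. *)
have h0 := dist_through_period axP ltm gtm.
have h1 := dist_mull T (C * al i)%g (al m).
have h2 := dist_mull T (al m) (C * al j)%g.
rewrite !eT in h1 h2.
move: h0; rewrite !dist_mull (dist_axis axP) => h0.
have h3 := dist_triangle (C * al i)%g (C * al (i + s))%g (T * al m)%g.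
have h4 := dist_triangle (al (m + 1)) (C * al j)%g (C * al (j + s))%g.
have h5 := dist_triangle (C * al i)%g (al m) (al (m + 1)).
have := four_point (T * al m)%g (al (m + 1)) (C * al i)%g (C * al (j + s))%g.
have h6 := dist_triangle (al m) (al (m + 1)) (C * al j)%g.
move: h3 h4 h5 h6; rewrite !dist_mull !(dist_axis axP).
rewrite (distC (T * al m)%g (C * al i)%g) (distC (al (m + 1)) (C * al i)%g).
have -> : `|(i + s - i)%R|%N = 1%N by rewrite /s; case: ifP; lia.
have -> : `|(j + s - j)%R|%N = 1%N by rewrite /s; case: ifP; lia.
have -> : `|(m + 1 - m)%R|%N = 1%N by lia.
have -> : `|(j + s - i)%R|%N = (`|(j - i)%R| + 1)%N.
  by move: nij; rewrite /s; case: ltrP; lia.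
by rewrite mulnDl mul1n; lia.
Qed.

Lemma proj_off C j : off_axis al C -> `|pr (C * al j)%g - pr C| <= 4 * ell%:Z.
Proof.
move=> offC; have := proj_off_lt 0 j offC; have := proj_off_lt j 0 offC.
by rewrite (axis0 axP) mulg1; lia.
Qed.

End TranslatedAxis.

Lemma off_axis_rev al ell C : is_axis al ell -> off_axis al C -> off_axis (rev_axis al) C.
Proof.
move=> axP offC s s1; rewrite /rev_axis => /(congr1 (fun x => x^-1)%g).
rewrite !invgM invgK mulgA -!(axisN axP) !opprK; exact: offC.
Qed.

(** Both [C * g] and a far point [al m] project beyond the whole translated axis, so their distances
    to each [C * al k] differ by a constant. Hence [g] and [C^-1 * al m] have the same projection,
    and [proj_off] controls the latter. *)
Lemma behrstock_gt al ell C g : is_axis al ell -> off_axis al C ->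
  proj al ell C + 4 * ell%:Z < proj al ell (C * g)%g ->
  `|proj al ell g - proj al ell C^-1%g| <= 4 * ell%:Z.
Proof.
move=> axP offC lth.
have ell_gt0 : (0 < ell)%N by case: axP.
have far k : proj al ell (C * al k)%g < proj al ell (C * g)%g.
  by apply: le_lt_trans lth; have := proj_off axP k offC; lia.
pose m : int := `|proj al ell C|%N%:Z + 4.
have gtm : proj al ell C + 4 * ell%:Z < proj al ell (al m).
  rewrite (proj_axis axP) /m.
  suff : `|proj al ell C|%N%:Z <= `|proj al ell C|%N%:Z * ell%:Z by lia.
  by rewrite ler_peMr //; lia.
have farm k : proj al ell (C * al k)%g < proj al ell (al m).
  by apply: le_lt_trans gtm; have := proj_off axP k offC; lia.
suff -> : proj al ell g = proj al ell (C^-1 * al m)%g.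
  exact: proj_off (off_axisV axP offC).
pose n := (len g + len (C^-1 * al m)%g + 1)%N.
have lt1 : (len g < n)%N by rewrite /n; lia.
have lt2 : (len (C^-1 * al m)%g < n)%N by rewrite /n; lia.
have b1 := busemann_dist axP lt1; have b2 := busemann_dist axP lt2.
have b3 : (dist g (al (- n%:Z)))%:Z = n%:Z * ell%:Z + busemann (rev_axis al) ell g.
  exact: (busemann_dist (is_axis_rev axP) lt1).
have b4 : (dist (C^-1 * al m)%g (al (- n%:Z)))%:Z
        = n%:Z * ell%:Z + busemann (rev_axis al) ell (C^-1 * al m)%g.
  exact: (busemann_dist (is_axis_rev axP) lt2).
(* The right-hand side does not depend on [k], so the cases [k = n] and [k = - n] compare both
   Busemann functions. *)
have e k : (dist g (al k))%:Z - (dist (C^-1 * al m)%g (al k))%:Z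
         = busemann (rev_axis al) ell (C * g)%g - busemann (rev_axis al) ell (al m).
  have := dist_proj axP (far k); have := dist_proj axP (farm k).
  rewrite !dist_mull -(dist_mull C (C^-1 * al m)%g) mulVKg.
  by rewrite (distC g) (distC (al m)); lia.
have e1 := e n%:Z; have e2 := e (- n%:Z).
by rewrite /proj; move: b3 b4 e1 e2; lia.
Qed.

(* Either g projects to the axis close to the projection of the translate of
   the axis by C^-1, or C g projects close to the translate by C. *)
Lemma behrstock al ell C g : is_axis al ell -> off_axis al C ->
  4 * ell%:Z < `|proj al ell g - proj al ell C^-1%g| ->
  `|proj al ell (C * g)%g - proj al ell C| <= 4 * ell%:Z.
Proof.
move=> axP offC lt1; rewrite leNgt; apply/negP => lt2.
move: lt1; rewrite ltNge => /negP; apply.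
have [lt|le] := ltP (proj al ell C + 4 * ell%:Z) (proj al ell (C * g)%g).
  exact: behrstock_gt lt.
have := behrstock_gt (is_axis_rev axP) (off_axis_rev axP offC) (g := g).
by rewrite !proj_rev; lia.
Qed.

(** A shortest bridge from the points of the axis to those of its translate by [B], found by descent
    on the distance. *)
Lemma min_dist al B : exists i j : int, forall k l : int,
  (dist (al i) (B * al j)%g <= dist (al k) (B * al l)%g)%N.
Proof.
pose P n := exists i j : int, dist (al i) (B * al j)%g = n.
have : exists n, P n by exists (dist (al 0) (B * al 0)%g), 0, 0.
case=> n0; have [n] := ubnP n0; elim: n n0 => // n IHn n0 ltn P0.
have [[m ltm Pm]|no] := classic (exists2 m, (m < n0)%N & P m).
  by apply: IHn Pm; apply: leq_trans ltm _; rewrite -ltnS.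
case: P0 => i [j e]; exists i, j => k l; rewrite leqNgt e; apply/negP => lt.
by apply: no; exists (dist (al k) (B * al l)%g); last by exists k, l.
Qed.

(** Otherwise some [al m] lies strictly between the projections of [B * al (k + i)] and [C * al j],
    hence on the translate by [B * al k] of a shortest bridge. Minimality forces [C * al j = al m],
    against strictness. The constant 10 is 4 + 4 from [proj_off] plus 2 for one period. *)
Lemma proj_bridge_le al ell B k : is_axis al ell ->
  off_axis al B -> off_axis al (B * al k * B)%g ->
  proj al ell (B * al k * B)%g <= proj al ell B + 10 * ell%:Z.
Proof.
move=> axP offB offC; rewrite leNgt; apply/negP => lt.
have ell_gt0 : (0 < ell)%N by case: axP.
have [i [j ij]] := min_dist al B.
set C := (B * al k * B)%g in offC lt *.
have h1 := proj_off axP j offC; have h2 := proj_off axP (k + i) offB.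
have lt2 : proj al ell (B * al (k + i))%g + 2 * ell%:Z < proj al ell (C * al j)%g.
  by move: h1 h2 lt; lia.
pose m := ((proj al ell (B * al (k + i))%g %/ (2 * ell%:Z))%Z + 1)%R.
have e2 : 2 * ell%:Z != 0 :> int by lia.
have d1 := divz_eq (proj al ell (B * al (k + i))%g) (2 * ell%:Z).
have d2 := ltz_mod (proj al ell (B * al (k + i))%g) e2.
have d3 := modz_ge0 (proj al ell (B * al (k + i))%g) e2.
have m1 : proj al ell (B * al (k + i))%g < 2 * m * ell%:Z.
  by rewrite /m; move: d1 d2 d3; lia.
have m2 : 2 * m * ell%:Z < proj al ell (C * al j)%g.
  by rewrite /m; move: d1 d2 d3 lt2; lia.
have := dist_through axP m1 m2.
have -> : (C * al j)%g = (B * al k * (B * al j))%g by rewrite !mulgA.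
have -> : (B * al (k + i))%g = (B * al k * al i)%g.
  by rewrite (axisD axP) mulgA.
rewrite dist_mull (distC _ (al m)) -(mulgA B (al k) (al i)) -(axisD axP) => e.
have := ij m (k + i); rewrite {}e => e.
have /dist_eq0 : dist (al m) (B * al k * (B * al j))%g = 0%N.
  by apply/eqP; move: e; rewrite -[X in (_ <= X)%N -> _]addn0 leq_add2l leqn0.
by rewrite !mulgA -/C => e3; move: m2; rewrite -e3 (proj_axis axP) ltxx.
Qed.

Lemma proj_bridge al ell B k : is_axis al ell ->
  off_axis al B -> off_axis al (B * al k * B)%g ->
  `|proj al ell (B * al k * B)%g - proj al ell B| <= 10 * ell%:Z.
Proof.
move=> axP offB offC; have h1 := proj_bridge_le axP offB offC.
have e : rev_axis al (- k) = al k by rewrite /rev_axis opprK.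
have := @proj_bridge_le _ ell B (- k) (is_axis_rev axP) (off_axis_rev axP offB).
rewrite e => /(_ (off_axis_rev axP offC)).
by rewrite !proj_rev; lia.
Qed.

End OffAxis.

(** * Cyclic reduction *)

Section IntPower.

Variable X : choiceType.
Implicit Types (x y z c : freegroup X) (w : seq (letter X)).
Local Open Scope ring_scope.

Definition intpow x (m : int) : freegroup X :=
  match m with Posz n => x ^+ n | Negz n => x ^- n.+1 end%g.

Lemma intpowB x (a b : nat) : intpow x (a%:Z - b%:Z) = (x ^+ a * x ^- b)%g.
Proof.
have [leba|ltab] := leqP b a.
  have -> : a%:Z - b%:Z = (a - b)%N%:Z by lia.
  by rewrite /intpow -expgnFr.
have -> : a%:Z - b%:Z = Negz (b - a).-1 by lia.
rewrite /intpow prednK ?subn_gt0 //.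
by rewrite expgnFr 1?ltnW // invgF.
Qed.

Lemma intpowD x m n : intpow x (m + n) = (intpow x m * intpow x n)%g.
Proof.
have decomp (k : int) : exists a b : nat, k = a%:Z - b%:Z.
  by case: k => k; [exists k, 0%N | exists 0%N, k.+1]; lia.
have [a [b ->]] := decomp m; have [c [d ->]] := decomp n.
have -> : a%:Z - b%:Z + (c%:Z - d%:Z) = (a + c)%N%:Z - (b + d)%N%:Z by lia.
rewrite !intpowB [(b + d)%N]addnC !expgnDr invgM !mulgA; congr (_ * _)%g.
rewrite -!mulgA; congr (_ * _)%g.
have cV : commute (x ^+ c)%g (x ^- b)%g by apply/commuteV/commuteX2.
by [].
Qed.

Lemma gmul_intpow (f : freegroup X -> freegroup X) :
  {morph f : x y / (x * y)%g} -> forall x m, f (intpow x m) = intpow (f x) m.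
Proof.
move=> fM x.
have f1 : f 1%g = 1%g by apply/(@mulgI _ (f 1%g)); rewrite -fM !mulg1.
have fX n : f (x ^+ n)%g = (f x ^+ n)%g.
  by elim: n => // n IHn; rewrite !expgS fM IHn.
case=> n /=; first exact: fX.
by rewrite -fX; apply/esym/mulg1_eq; rewrite -fM mulgV f1.
Qed.

(** In a tree, a path whose consecutive triples are geodesic is geodesic. The induction carries two
    consecutive exponents for the four-point condition. *)
Lemma len_expg x n : len (x * x)%g = (2 * len x)%N -> len (x ^+ n)%g = (n * len x)%N.
Proof.
move=> len2; have [x0|x_gt0] := posnP (len x).
  by rewrite (len_eq0 x0) expg1n len1 muln0.
have step : forall m, dist (x ^+ m)%g (x ^+ m.+1)%g = len x.
  by move=> m; rewrite expgSr /dist mulKg.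
have step2 m : dist (x ^+ m)%g (x ^+ m.+2)%g = (2 * len x)%N.
  by rewrite !expgSr /dist !mulgA -mulgA -mulgA mulKg.
suff: len (x ^+ n)%g = (n * len x)%N /\ len (x ^+ n.+1)%g = (n.+1 * len x)%N.
  by case.
elim: n => [|n [IHn IHn1]]; first by rewrite len1 expg1 mul1n.
split=> //; case: n IHn IHn1 => [|n] IHn IHn1; first by rewrite expg2.
have := four_point 1%g (x ^+ n.+2)%g x (x ^+ n.+3)%g.
have := dist_triangle 1%g (x ^+ n.+2)%g (x ^+ n.+3)%g.
have e m : dist x (x ^+ m.+1)%g = len (x ^+ m)%g.
  by rewrite expgS -{1}[x]mulg1 dist_mull dist1l.
by rewrite (distC (x ^+ n.+2)%g x) !e !dist1l !step IHn IHn1 !mulSn; lia.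
Qed.

Lemma len_fgclass w : reduced w -> len (fgclass w : freegroup X) = size w.
Proof. by move=> rw; rewrite /len /= reduce_id. Qed.

Lemma fgclass_eq1 w : reduced w -> (fgclass w == 1%g :> freegroup X) = (w == [::]).
Proof. by move=> rw; rewrite -(inj_eq val_inj) /= reduce_id. Qed.

(** First and last letters are stripped as long as they are mutually inverse; when they are not, the
    word concatenated with itself is reduced. *)
Lemma cyclic_reduction x : x != 1%g ->
  exists c y, [/\ x = (c * y * c^-1)%g, y != 1%g & len (y * y)%g = (2 * len y)%N].
Proof.
have [n] := ubnP (len x); elim: n x => // n IHn x ltn x1.
have [w rw ex] : exists2 w, reduced w & x = fgclass w.
  by exists x; [exact: valP | rewrite fgclass_val].
rewrite {x}ex in ltn x1 *; case: w rw ltn x1 => [|a w] rw.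
  by rewrite fgclass_eq1.
rewrite len_fgclass // => ltn _.
have [e|ne] := eqVneq (last a w) (linv a); last first.
  exists 1%g, (fgclass (a :: w)); rewrite mul1g invg1 mulg1 fgclass_eq1 //.
  split=> //; rewrite -fgclass_cat !len_fgclass ?size_cat ?addnn ?mul2n //.
  by rewrite reduced_cat rw /=; apply: contra ne => /eqP {2}->; rewrite linvK.
have : w != [::].
  by apply: contraPneq e => -> /= /(congr1 snd) /=; case: (a.2).
case/lastP: w rw e ltn => // w b rw; rewrite last_rcons => eb ltn _.
have rw' : reduced w.
  by move: rw; rewrite -cat1s -cats1 !reduced_cat => /and3P[_ /and3P[]].
have ex : fgclass (a :: rcons w b)
        = (fgclass [:: a] * fgclass w * (fgclass [:: a])^-1)%g.
  by rewrite -fgclass_winv -!fgclass_cat -cats1 eb.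
have w1 : fgclass w != 1%g.
  rewrite fgclass_eq1 //; apply: contraTneq rw => ->.
  by rewrite /reduced /= eb eqxx.
have ltw : (len (fgclass w) < n)%N.
  by rewrite len_fgclass //; rewrite /= size_rcons in ltn; lia.
have [c [y [ey y1 l2]]] := IHn _ ltw w1.
exists (fgclass [:: a] * c)%g, y; split=> //.
by rewrite ex ey invgM !mulgA.
Qed.

Lemma intpow_axis x : x != 1%g -> len (x * x)%g = (2 * len x)%N ->
  is_axis (intpow x) (len x).
Proof.
move=> x1 l2; split; first exact: intpowD.
  by case=> n /=; rewrite ?lenV len_expg.
by rewrite lt0n; apply: contraNneq x1 => /len_eq0 ->.
Qed.

(* Both deg and, up to a constant, len of the powers of x are those of the
   powers of its positive conjugate. *)
Lemma positive_conj x c : len (x * x)%g = (2 * len x)%N ->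
  positive (c^-1 * x * c)%g -> deg x = (len x)%:Z.
Proof.
move=> l2 /positive_deg.
have [p ep] : exists p : freegroup X, p = (c^-1 * x * c)%g by eexists.
rewrite -ep => dp; have dpx : deg p = deg x by rewrite ep !degM degV; lia.
have degX y n : deg (y ^+ n)%g = n%:Z * deg y.
  by elim: n => [|n IHn]; rewrite ?deg1 ?expgS ?degM ?IHn; lia.
have lenX y n : (len (y ^+ n)%g <= n * len y)%N.
  elim: n => [|n IHn]; first by rewrite len1.
  by rewrite expgS mulSn; apply: leq_trans (lenM _ _) _; rewrite leq_add2l.
(* Conjugation by [c] adds at most [2 * len c] to a length, which this power outweighs if
   [len p < len x]. *)
have [n en] : exists n, n = (2 * len c + 1)%N by exists (2 * len c + 1)%N.
have e : (x ^+ n = c * p ^+ n * c^-1)%g.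
  elim: (n) => [|m IHm]; first by rewrite mulg1 mulgV.
  by rewrite !expgS IHm {2}ep !mulgA mulgV mul1g.
have := len_expg n l2; rewrite e => l.
have := lenM (c * p ^+ n)%g c^-1%g; have := lenM c (p ^+ n)%g; have := lenX p n.
rewrite lenV l => h1 h2 h3; have dl := deg_le_len x.
apply/eqP; rewrite eq_le dl /= leNgt; apply/negP => lt.
have lp : (len p < len x)%N by lia.
have : (n * len p + n <= n * len x)%N by rewrite addnC -mulnS leq_mul2l lp orbT.
lia.
Qed.

End IntPower.

(** * Mountains *)

Section Mountains.

Variable X : choiceType.
Implicit Types (x y z t g C D : freegroup X) (L m n : int).
Implicit Types (ps : seq (int * int)).
Local Open Scope ring_scope.

(** Integer parameters, also for [L], make the family stable under inversion in the sense of
    [mountainsV]. *)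
Fixpoint mountains (al : int -> freegroup X) B L ps : freegroup X :=
  if ps is (n, m) :: ps' then
    (B * al (- n) * B * (al L * (B^-1 * al m * B^-1 * (al L * mountains al B L ps'))))%g
  else 1%g.

Variables (al : int -> freegroup X) (ell : nat) (B : freegroup X).
Hypothesis axP : is_axis al ell.
Hypothesis offB : off_axis al B.
Hypothesis offBB : forall k, off_axis al (B * al k * B)%g.
Hypothesis offVV : forall k, off_axis al (B^-1 * al k * B^-1)%g.
Let offV : off_axis al B^-1%g := off_axisV axP offB.
Let ell_gt0 : (0 < ell)%N. Proof. by case: axP. Qed.
Local Notation pr := (proj al ell).
Local Notation tail := (mountains al B).

Let big_shift L : 15 <= `|L| ->
  15 * ell%:Z <= L * ell%:Z \/ L * ell%:Z <= - (15 * ell%:Z).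
Proof.
move=> L15; have [le|le] : 15 <= L \/ L <= - 15 by lia.
  by left; rewrite ler_wpM2r //.
by right; rewrite -mulNr ler_wpM2r //.
Qed.

(** The factor [al L] moves the projection by at least [30 * ell], out of the exceptional range of
    [behrstock]: 30 - 14 exceeds 4. *)
Lemma proj_cross C L t : off_axis al C -> 15 <= `|L| ->
  `|pr t - pr C^-1%g| <= 14 * ell%:Z ->
  `|pr (C * (al L * t))%g - pr C| <= 4 * ell%:Z.
Proof.
move=> offC /big_shift bL le; apply: (behrstock axP offC).
by rewrite (proj_shift axP); move: bL le; lia.
Qed.

(** By [proj_bridge], the projections of [C * al k * C] and of its inverse stay within [10 * ell] of
    those of [C] and [C^-1], uniformly in [k]. Now 30 - 14 - 10 exceeds 4, and the new error is 4 +
    10. *)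
Lemma proj_pass C k L t : off_axis al C ->
  off_axis al (C * al k * C)%g ->
  off_axis al (C^-1 * al (- k) * C^-1)%g -> 15 <= `|L| ->
  `|pr t - pr C^-1%g| <= 14 * ell%:Z ->
  `|pr (C * al k * C * (al L * t))%g - pr C| <= 14 * ell%:Z.
Proof.
move=> offC offCC offCV /big_shift bL le.
have h1 := proj_bridge axP offC offCC.
have h2 := proj_bridge axP (off_axisV axP offC) offCV.
have e : ((C * al k * C)^-1 = C^-1 * al (- k) * C^-1)%g.
  by rewrite (axisN axP) !invgM mulgA.
suff : `|pr (C * al k * C * (al L * t))%g - pr (C * al k * C)%g| <= 4 * ell%:Z.
  by move: h1; lia.
apply: (behrstock axP offCC); rewrite e (proj_shift axP).
by set q := pr (C^-1 * al (- k) * C^-1)%g in h2 *; move: bL le h2; lia.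
Qed.

Lemma proj_down m L t : 15 <= `|L| -> `|pr t - pr B| <= 14 * ell%:Z ->
  `|pr (B^-1 * al m * B^-1 * (al L * t))%g - pr B^-1%g| <= 14 * ell%:Z.
Proof.
by move=> L15 le; apply: proj_pass; rewrite ?invgK //; apply: offBB.
Qed.

Lemma proj_up n L t : 15 <= `|L| -> `|pr t - pr B^-1%g| <= 14 * ell%:Z ->
  `|pr (B * al n * B * (al L * t))%g - pr B| <= 14 * ell%:Z.
Proof. by move=> L15 le; apply: proj_pass => //; apply: offVV. Qed.

Hypothesis prB : `|pr B| <= 10 * ell%:Z.

Lemma proj_mountains L ps : 15 <= `|L| ->
  `|pr (tail L ps) - pr B| <= 14 * ell%:Z.
Proof.
move=> L15; elim: ps => [|[n m] ps IHps] /=.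
  by rewrite (proj1g axP); move: prB; lia.
by apply: proj_up => //; apply: proj_down.
Qed.

Lemma mountains_cat L ps qs : tail L (ps ++ qs) = (tail L ps * tail L qs)%g.
Proof.
elim: ps => [|[n m] ps IHps] /=; first by rewrite mul1g.
by rewrite IHps !mulgA.
Qed.

Definition swap2 (p : int * int) := (p.2, p.1).

(** Inversion exchanges the two kinds of factors, so that bounds for suffixes of a word also apply
    to the inverses of its prefixes. *)
Lemma mountainsV L ps :
  ((al L * tail L ps)^-1 = al (- L) * tail (- L) (rev (map swap2 ps)))%g.
Proof.
elim: ps => [|[n m] ps IHps]; first by rewrite /= !mulg1 (axisN axP).
rewrite map_cons rev_cons -cats1 mountains_cat [RHS]mulgA -IHps [tail L _]/=.
rewrite [tail (- L) _]/= !mulg1.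
by rewrite !(axisN axP) !invgM !invgK !mulgA.
Qed.

(* The gap 15 makes the translation by al (+-15), which moves projections by
   30 * ell, exceed the sum of the error terms 14, 10 and 4 below. *)
Let word ps : freegroup X := (al 15 * tail 15 ps)%g.

(** [word ps] and its inverse project to opposite sides of the identity, which therefore lies on the
    geodesic between them. So [word ps] is cyclically reduced, as [positive_conj] requires. *)
Lemma len_word_sqr ps : len (word ps * word ps)%g = (2 * len (word ps))%N.
Proof.
have := dist_through axP (x := (word ps)^-1%g) (y := word ps) (m := 0).
rewrite (axis0 axP) dist1r dist1l lenV /dist invgK => ->; first by rewrite mul2n addnn.
  rewrite /word mountainsV (proj_shift axP).
  have := @proj_mountains (- 15) (rev (map swap2 ps)) isT.
  by set q := pr (tail _ _); move: prB ell_gt0; lia.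
rewrite /word (proj_shift axP); have := @proj_mountains 15 ps isT.
by move: prB ell_gt0; lia.
Qed.

(** Since [deg] is at most [len] on every piece of the geodesic, equality on the whole forces
    equality on the period of the axis that it contains. In [deg_backward] that period is traversed
    in the opposite direction. *)
Lemma deg_forward x y : deg (x^-1 * y)%g = (dist x y)%:Z ->
  pr x + 4 * ell%:Z < pr y -> ell%:Z <= deg (al 1).
Proof.
move=> dxy /(between_multiples axP)[k lt1 lt2].
have e := dist_through_period axP lt1 lt2.
have d1 := deg_le_len (x^-1 * al k)%g.
have d2 := deg_le_len ((al (k + 1))^-1 * y)%g.
have : deg (x^-1 * y)%g = deg (x^-1 * al k)%g + deg (al 1) + deg ((al (k + 1))^-1 * y)%g.
  rewrite -!degM; congr deg; rewrite -!mulgA; congr (_ * _)%g.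
  by rewrite !mulgA -(axisD axP) mulgV mul1g.
by move: e d1 d2; rewrite dxy /dist; lia.
Qed.

Lemma deg_backward x y : deg (x^-1 * y)%g = (dist x y)%:Z ->
  pr y + 4 * ell%:Z < pr x -> ell%:Z <= - deg (al 1).
Proof.
move=> dxy /(between_multiples axP)[k lt1 lt2].
have e := dist_through_period axP lt1 lt2.
have d1 := deg_le_len (x^-1 * al (k + 1))%g.
have d2 := deg_le_len ((al k)^-1 * y)%g.
have : deg (x^-1 * y)%g = deg (x^-1 * al (k + 1))%g - deg (al 1) + deg ((al k)^-1 * y)%g.
  rewrite -degV -!degM; congr deg; rewrite -!mulgA; congr (_ * _)%g.
  by rewrite !mulgA (axisD axP) mulgK mulgV mul1g.
move: e d1 d2; rewrite dxy distC (distC y) (distC _ x) /dist; lia.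
Qed.

(* Were the inequality to fail, the geodesic from 1 to the positive word would
   follow a period of the axis backwards, which gives al 1 a negative degree. *)
Lemma mountains_up ps1 n m ps2 :
  deg (word (ps1 ++ (n, m) :: ps2)) = (len (word (ps1 ++ (n, m) :: ps2)))%:Z ->
  deg (al 1) = ell%:Z ->
  pr B^-1%g <= pr B - 2 * n * ell%:Z + 12 * ell%:Z.
Proof.
move=> pos dA; rewrite leNgt; apply/negP => lt.
(* The word is cut around the factor [al (- n)]. Both ends are known up to [4 * ell] and
   [deg_backward] needs a gap of another [4 * ell], whence 12. *)
pose g := (al 15 * tail 15 ps1 * B)%g.
pose h := (B * (al 15 * (B^-1 * al m * B^-1 * (al 15 * tail 15 ps2))))%g.
have e : word (ps1 ++ (n, m) :: ps2) = (g * (al (- n) * h))%g.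
  by rewrite /word mountains_cat /= /g /h !mulgA.
have hh : `|pr h - pr B| <= 4 * ell%:Z.
  by apply: proj_cross => //; apply: proj_down => //; apply: proj_mountains.
have hg : `|pr g^-1%g - pr B^-1%g| <= 4 * ell%:Z.
  rewrite /g invgM mountainsV; apply: proj_cross => //.
  by rewrite invgK; apply: proj_mountains.
have := @deg_backward g^-1%g (al (- n) * h)%g.
rewrite /dist invgK -e pos dA (proj_shift axP) => /(_ erefl).
by move: lt hh hg; lia.
Qed.

(** The argument of [mountains_up], with the cut around the factor [al m] between two [B^-1]. *)
Lemma mountains_down ps1 n m ps2 :
  deg (word (ps1 ++ (n, m) :: ps2)) = (len (word (ps1 ++ (n, m) :: ps2)))%:Z ->
  deg (al 1) = ell%:Z ->
  pr B <= pr B^-1%g + 2 * m * ell%:Z + 12 * ell%:Z.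
Proof.
move=> pos dA; rewrite leNgt; apply/negP => lt.
pose g := (al 15 * tail 15 ps1 * (B * al (- n) * B) * al 15 * B^-1)%g.
pose h := (B^-1 * (al 15 * tail 15 ps2))%g.
have e : word (ps1 ++ (n, m) :: ps2) = (g * (al m * h))%g.
  by rewrite /word mountains_cat /= /g /h !mulgA.
have hh : `|pr h - pr B^-1%g| <= 4 * ell%:Z.
  by apply: proj_cross; rewrite ?invgK //; apply: proj_mountains.
have hg : `|pr g^-1%g - pr B| <= 4 * ell%:Z.
  have -> : (g^-1 = B * (al (- 15) * (B^-1 * al n * B^-1 *
     (al (- 15) * tail (- 15) (rev (map swap2 ps1))))))%g.
    rewrite -mountainsV /g; move: (al 15 * tail 15 ps1)%g => u.
    by rewrite !invgM !(axisN axP) !invgK !mulgA.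
  by apply: proj_cross => //; apply: proj_down => //; apply: proj_mountains.
have := @deg_backward g^-1%g (al m * h)%g.
rewrite /dist invgK -e pos dA (proj_shift axP) => /(_ erefl).
by move: lt hh hg; lia.
Qed.

Lemma mountains_not_positive ps n m n' m' :
  (n, m) \in ps -> (n', m') \in ps -> m' + 13 <= n ->
  deg (word ps) <> (len (word ps))%:Z.
Proof.
move=> ips ips' le pos.
(* The geodesic follows a period of the axis forward, as 30 - 14 - 10 exceeds 4; this fixes the sign
   of the degree. *)
have dA : deg (al 1) = ell%:Z.
  apply/eqP; rewrite eq_le; case: axP => _ l _.
  have := deg_le_len (al 1); rewrite l mul1n => -> /=.
  apply: (@deg_forward 1%g (word ps)); rewrite ?invg1 ?mul1g ?dist1l //.
  rewrite (proj1g axP) /word (proj_shift axP).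
  have := @proj_mountains 15 ps isT; move: prB ell_gt0; lia.
have split2 p : p \in ps -> exists p1 p2, ps = p1 ++ p :: p2.
  by case/splitPr => p1 p2; exists p1, p2.
have [p1 [p2 e1]] := split2 _ ips; have [q1 [q2 e2]] := split2 _ ips'.
(* The two bounds add up to [2 * n * ell <= 2 * m' * ell + 24 * ell], whence the constant 13. *)
have h1 : pr B^-1%g <= pr B - 2 * n * ell%:Z + 12 * ell%:Z.
  by apply: (@mountains_up p1 n m p2) => //; rewrite -e1.
have h2 : pr B <= pr B^-1%g + 2 * m' * ell%:Z + 12 * ell%:Z.
  by apply: (@mountains_down q1 n' m' q2) => //; rewrite -e2.
have : (m' + 13) * ell%:Z <= n * ell%:Z by rewrite ler_wpM2r.
by move: h1 h2 ell_gt0; lia.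
Qed.

End Mountains.

(** * Automorphisms of the free group *)

Section FreeExtension.

Variable X : choiceType.
Implicit Types (a b : letter X) (u v w : seq (letter X)) (g h : freegroup X).
Implicit Types (x y z : X).

Definition gen x : freegroup X := fgclass [:: (x, false)].

Lemma genV x : fgclass [:: (x, true)] = (gen x)^-1%g.
Proof. by rewrite -fgclass_winv. Qed.

Lemma fgclass_nseq n x : fgclass (nseq n (x, false)) = (gen x ^+ n)%g.
Proof.
elim: n => [|n IHn] /=; first exact: fgclass_nil.
by rewrite fgclass_cons IHn expgS.
Qed.

Lemma fgclass_nseqV n x : fgclass (nseq n (x, true)) = (gen x ^- n)%g.
Proof.
elim: n => [|n IHn] /=; first by rewrite fgclass_nil invg1.
by rewrite fgclass_cons IHn expgSr invgM genV.
Qed.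

Section Extension.

Variable f : X -> freegroup X.

Definition ext_letter a : freegroup X := if a.2 then (f a.1)^-1%g else f a.1.
Definition ext_word w : freegroup X := (\prod_(a <- w) ext_letter a)%g.
Definition ext g : freegroup X := ext_word g.

Lemma ext_letterV a : ext_letter (linv a) = (ext_letter a)^-1%g.
Proof. by case: a => x [] //; rewrite /ext_letter /= invgK. Qed.

Lemma ext_word_reduce w : ext_word (reduce w) = ext_word w.
Proof.
elim: w => //= a w IHw; rewrite /ext_word big_cons -/(ext_word w) -IHw.
case: (reduce w) => [|b v] /=; first by rewrite big_seq1 /ext_word big_nil mulg1.
case: eqP => [->|_]; rewrite /ext_word !big_cons //.
by rewrite ext_letterV mulVKg.
Qed.

Lemma ext_mulg : {morph ext : g h / (g * h)%g}.
Proof. by move=> g h; rewrite /ext ext_word_reduce /ext_word big_cat. Qed.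

HB.instance Definition _ :=
  isMultiplicative.Build (freegroup X) (freegroup X) ext ext_mulg.

Lemma ext_gen x : ext (gen x) = f x.
Proof. by rewrite /ext /ext_word big_seq1. Qed.

End Extension.

Lemma multiplicative1 (h : {multiplicative freegroup X -> freegroup X}) :
  h 1%g = 1%g.
Proof. by apply/(@mulgI _ (h 1%g)); rewrite -gmulfM !mulg1. Qed.

Lemma multiplicative_id (h : {multiplicative freegroup X -> freegroup X}) :
  (forall x, h (gen x) = gen x) -> h =1 id.
Proof.
move=> hgen g; rewrite -(fgclass_val g); elim: (fgword g) => [|a w IHw].
  by rewrite fgclass_nil multiplicative1.
rewrite fgclass_cons gmulfM IHw; congr (_ * _)%g.
case: a => x []; last exact: hgen.
rewrite genV; apply/esym/mulg1_eq.
by rewrite -{1}hgen -gmulfM mulgV multiplicative1.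
Qed.

Definition transvection z g x : freegroup X := if x == z then (gen z * g)%g else gen x.

Lemma ext_transvection_pow x y g n : x != y ->
  ext (transvection x g) (gen y ^+ n)%g = (gen y ^+ n)%g.
Proof.
move=> nxy; elim: n => [|n IHn]; first exact: multiplicative1.
by rewrite expgS ext_mulg IHn ext_gen /transvection eq_sym (negPf nxy).
Qed.

(** The power of [gen y] is fixed, so the transvection by its inverse is the inverse map; by
    [multiplicative_id] it suffices to check this on generators. *)
Lemma transvection_bij x y n : x != y -> bijective (ext (transvection x (gen y ^+ n)%g)).
Proof.
move=> nxy; have fix1 g : ext (transvection x g) (gen y ^+ n)%g = (gen y ^+ n)%g.
  exact: ext_transvection_pow.
have fix2 g : ext (transvection x g) (gen y ^- n)%g = (gen y ^- n)%g.
  by apply/esym/mulg1_eq; rewrite -{1}(fix1 g) -ext_mulg mulgV multiplicative1.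
exists (ext (transvection x (gen y ^- n)%g)) => g.
  apply: (@multiplicative_id (ext _ \o ext _)) => z /=.
  rewrite ext_gen /transvection; case: eqP => [->|nz]; last first.
    by rewrite ext_gen /transvection; case: eqP.
  by rewrite ext_mulg fix1 ext_gen /transvection eqxx mulgVK.
apply: (@multiplicative_id (ext _ \o ext _)) => z /=.
rewrite ext_gen /transvection; case: eqP => [->|nz]; last first.
  by rewrite ext_gen /transvection; case: eqP.
by rewrite ext_mulg fix2 ext_gen /transvection eqxx mulgK.
Qed.

Lemma positive_reduced w : positive w -> reduced w.
Proof.
case: w => // a w /= /andP[]; rewrite /reduced /=.
elim: w a => //= b w IHw a na /andP[nb pw]; rewrite IHw // andbT.
by apply: contraNneq nb => ->; rewrite /= na.
Qed.

Lemma positiveM g h : positive g -> positive h -> positive (g * h)%g.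
Proof.
move=> pg ph; have pgh : positive (g ++ h) by rewrite /positive all_cat; apply/andP.
by rewrite /= reduce_id // positive_reduced.
Qed.

Lemma positiveX g n : positive g -> positive (g ^+ n)%g.
Proof. by move=> pg; elim: n => // n IHn; rewrite expgS positiveM. Qed.

End FreeExtension.

(** * Mountain words as group elements *)

Section MountainWords.

Variables (X : choiceType) (x y : X) (L : nat).
Implicit Types (ps : seq (nat * nat)).

Local Notation a := (x, false).
Local Notation a' := (x, true).
Local Notation b := (y, false).
Local Notation b' := (y, true).

Definition mountain (p : nat * nat) : seq (letter X) :=
  b :: nseq p.1 a' ++ b :: nseq L a ++ b' :: nseq p.2 a ++ b' :: nseq L a.

Definition mountain_word ps : seq (letter X) :=
  nseq L a ++ flatten [seq mountain p | p <- ps].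

Definition mountain_exps ps : seq (int * int) :=
  [seq (p.1%:Z, p.2%:Z)%R | p <- ps].

Lemma fgclass_mountain_word ps :
  fgclass (mountain_word ps) =
  (intpow (gen x) L * mountains (intpow (gen x)) (gen y) L (mountain_exps ps))%g.
Proof.
rewrite fgclass_cat fgclass_nseq; congr (_ * _)%g.
elim: ps => [|[n m] ps IHps]; first exact: fgclass_nil.
rewrite [LHS](fgclass_cat (mountain (n, m))) IHps.
have -> : mountain (n, m) =
    [:: b] ++ nseq n a' ++ [:: b] ++ nseq L a ++ [:: b'] ++
    nseq m a ++ [:: b'] ++ nseq L a.
  by [].
rewrite !fgclass_cat !fgclass_nseq fgclass_nseqV !genV /=.
have -> : intpow (gen x) (- n%:Z)%R = (gen x ^- n)%g.
  have := intpowB (gen x) 0 n; rewrite mul1g => <-; congr intpow; lia.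
by rewrite !mulgA.
Qed.

End MountainWords.

(** * Reducedness and potential positivity of mountain words *)

Section MountainPP.

Variables (X : choiceType) (x y : X).
Hypothesis nxy : x != y.
Implicit Types (ps : seq (nat * nat)) (w u v : seq (letter X)).

Local Notation a := (x, false).
Local Notation a' := (x, true).
Local Notation b := (y, false).
Local Notation b' := (y, true).
Local Notation mword := (mountain_word x y).

Lemma reduced_run (d e c : letter X) k w :
  d.1 != c.1 -> e.1 != c.1 -> (k == 0 -> e != linv d) ->
  reduced (e :: w) -> reduced (d :: nseq k c ++ e :: w).
Proof.
move=> ndc nec ned rw; rewrite /reduced /= cat_path /=.
have -> : path (fun a b => b != linv a) e w by [].
rewrite andbT; case: k ned => [->//|k _] /=.
have -> : last c (nseq k c) = c by elim: k.
have -> : e != linv c by apply: contraNneq nec => ->.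
have -> : c != linv d by apply: contraNneq ndc => ->.
rewrite andbT /=; elim: k => //= k ->; rewrite andbT.
by case: c {nec ndc} => z []; rewrite /linv xpair_eqE andbF.
Qed.

Lemma reduced_nseq k (d c : letter X) : d.1 != c.1 -> reduced (d :: nseq k c).
Proof.
move=> ndc; rewrite /reduced /=; case: k => //= k.
have -> : c != linv d by apply: contraNneq ndc => ->.
elim: k => //= k ->; rewrite andbT.
by case: c {ndc} => z []; rewrite /linv xpair_eqE andbF.
Qed.

Let nyx : y != x. Proof. by rewrite eq_sym. Qed.

(** The conjugate is represented by a reduced word of length at least 3, so it is no generator. An
    injective endomorphism will turn this into [off_axis]. *)
Lemma off_gen_word w (s : int) : `|s|%N = 1%N ->
  (forall c : bool, reduced (w ++ (x, c) :: winv w)) -> w != [::] ->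
  (fgclass w * intpow (gen x) s * (fgclass w)^-1)%g <> gen x.
Proof.
move=> s1 rw w0.
have [c ->] : exists c, intpow (gen x) s = fgclass [:: (x, c)].
  have [->|->] : (s = 1 \/ s = - 1)%R by lia.
    by exists false.
  by exists true; rewrite genV.
rewrite -fgclass_winv -!fgclass_cat -catA /= => /(congr1 (@len X)).
rewrite /gen !len_fgclass // size_cat /= /winv size_rev size_map.
by case: w w0 {rw} => //= ? ?; lia.
Qed.

Lemma off_gen (e : bool) (s : int) : `|s|%N = 1%N ->
  (fgclass [:: (y, e)] * intpow (gen x) s * (fgclass [:: (y, e)])^-1)%g <> gen x.
Proof.
move=> s1; apply: off_gen_word => // c.
by rewrite /reduced /= /linv /= !xpair_eqE (negPf nxy) (negPf nyx).
Qed.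

Lemma off_pass (e : bool) (k s : int) : `|s|%N = 1%N ->
  (fgclass [:: (y, e)] * intpow (gen x) k * fgclass [:: (y, e)] *
   intpow (gen x) s *
   (fgclass [:: (y, e)] * intpow (gen x) k * fgclass [:: (y, e)])^-1)%g <> gen x.
Proof.
move=> s1; have [c [n ->]] : exists c n, intpow (gen x) k = fgclass (nseq n (x, c)).
  case: k => n; [exists false, n | exists true, n.+1].
    by rewrite fgclass_nseq.
  by rewrite fgclass_nseqV.
pose w0 := (y, e) :: nseq n (x, c) ++ [:: (y, e)].
rewrite -!fgclass_cat -[(_ ++ _) ++ _]/w0; apply: off_gen_word => // d.
have -> : w0 ++ (x, d) :: winv w0
        = (y, e) :: nseq n (x, c) ++ [:: (y, e), (x, d) & winv w0].
  by rewrite /w0 /= -catA.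
apply: reduced_run => //; first by rewrite /linv xpair_eqE eqxx; case: (e).
rewrite {}/w0.
have -> : winv ((y, e) :: nseq n (x, c) ++ [:: (y, e)])
   = (y, ~~ e) :: nseq n (x, ~~ c) ++ [:: (y, ~~ e)].
  by rewrite /winv /= map_cat map_nseq rev_cons rev_cat rev_nseq /= -cats1.
have r : reduced ((y, ~~ e) :: nseq n (x, ~~ c) ++ [:: (y, ~~ e)]).
  by apply: reduced_run => //=; rewrite /linv /= xpair_eqE eqxx; case: e.
move: r; rewrite /reduced /= => ->.
by rewrite /linv /= !xpair_eqE (negPf nxy) (negPf nyx).
Qed.

Lemma mountain_word_cyclically_reduced L ps : 0 < L ->
  cyclically_reduced (mword L ps).
Proof.
move=> L0; have nL c d : (L == 0) -> c != linv d :> letter X by rewrite eqn0Ngt L0.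
(* The letter [b'] in front lets [reduced_run] handle the initial run as well; [path_sorted] removes
   it afterwards. *)
have red : reduced (b' :: nseq L a ++ flatten [seq mountain x y L p | p <- ps]).
  elim: ps => [|[n m] ps IHps]; first by rewrite /= cats0; apply: reduced_nseq.
  rewrite [flatten _]/= /mountain /= -?catA /= -?catA /= -?catA /= -?catA /=.
  apply: reduced_run => //; first exact: nL.
  apply: reduced_run => //; first by rewrite /linv xpair_eqE andbF.
  apply: reduced_run => //; first exact: nL.
  by apply: reduced_run => //; rewrite /linv xpair_eqE andbF.
apply/andP; split; first exact: path_sorted red.
have lst : last a (mword L ps) = a.
  rewrite /mountain_word last_cat.
  have -> : last a (nseq L a) = a by elim: (L).
  elim: ps {red} => // [[n m] ps] IHps.
  rewrite -[flatten _]/(mountain x y L (n, m) ++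
    flatten [seq mountain x y L p | p <- ps]).
  rewrite last_cat; suff -> : last a (mountain x y L (n, m)) = a by [].
  rewrite /mountain /= !(last_cat, last_cons).
  by case: (L) L0 => //= k _; elim: k.
case: (L) L0 lst => //= k _; rewrite /mountain_word /= => ->.
by rewrite /linv xpair_eqE andbF.
Qed.

(* The automorphism is b |-> b a^n followed by a |-> a b^2. *)
Lemma mountain_word_pp K L n : 0 < L ->
  potentially_positive (fgclass (mword L (nseq K (n, n)))).
Proof.
move=> L0; pose t1 : {multiplicative freegroup X -> freegroup X} :=
  ext (transvection y (gen x ^+ n)%g).
pose t2 : {multiplicative freegroup X -> freegroup X} :=
  ext (transvection x (gen y ^+ 2)%g).
exists (t2 \o t1); first by apply: bij_comp; apply: transvection_bij.
have px z : positive (gen z) by [].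
pose al := (gen x * gen y ^+ 2)%g.
have t1E z : t1 (gen z) = transvection y (gen x ^+ n)%g z by apply: ext_gen.
have t2E z : t2 (gen z) = transvection x (gen y ^+ 2)%g z by apply: ext_gen.
have e1 : (t2 \o t1) (gen x) = al.
  by rewrite /= t1E /transvection (negPf nxy) t2E /transvection eqxx.
have tX m : t2 (gen x ^+ m)%g = (al ^+ m)%g.
  elim: m => [|m IHm]; first exact: multiplicative1.
  by rewrite !expgS gmulfM IHm t2E /transvection eqxx.
have e2 : (t2 \o t1) (gen y) = (gen y * al ^+ n)%g.
  by rewrite /= t1E /transvection eqxx gmulfM tX t2E /transvection (negPf nyx).
have pal : positive al by apply: positiveM => //; apply: positiveX.
pose t : {multiplicative freegroup X -> freegroup X} := t2 \o t1.
have tP z m : t (intpow (gen z) m) = intpow (t (gen z)) m.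
  by apply: gmul_intpow; apply: gmulfM.
have tV g : t g^-1%g = (t g)^-1%g.
  by apply/esym/mulg1_eq; rewrite -gmulfM mulgV multiplicative1.
have {}e1 : t (gen x) = al := e1; have {}e2 : t (gen y) = (gen y * al ^+ n)%g := e2.
have tN m : t (gen x ^+ m)%g = (al ^+ m)%g by rewrite -e1; apply: (tP x m).
rewrite -/t fgclass_mountain_word gmulfM positiveM //.
  by rewrite tP e1; apply: positiveX.
elim: K => [|K IHK]; first by rewrite multiplicative1.
have al_negn : intpow al (- n%:Z)%R = (al ^- n)%g.
  have := intpowB al 0 n; rewrite mul1g => <-; congr intpow; lia.
rewrite [mountains _ _ _ _]/= -/(mountain_exps (nseq K (n, n))).
move: IHK; move: (mountains _ _ _ _) => q pq.
rewrite !gmulfM !tP !tV !e1 !e2 al_negn mulgK.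
rewrite !tN.
have e : (al ^+ n * al ^+ L * al ^- n = al ^+ L)%g.
  by rewrite -expgnDr addnC expgnDr mulgK.
(* The powers [al^n] cancel, which leaves [y^2 al^L y^-2 al^L]. As [al] ends in [y^2], the last
   factor of the first [al^L] absorbs [y^-2]; this uses [0 < L]. *)
have -> : (gen y * (gen y * al ^+ n) *
    (al ^+ L * ((gen y * al ^+ n)^-1 * al ^+ n * (gen y * al ^+ n)^-1 *
    (al ^+ L * t q))) = gen y * gen y * (al ^+ L.-1 * gen x) * (al ^+ L * t q))%g.
  rewrite !invgM !mulgA mulgK; congr (_ * _ * _)%g.
  rewrite -!(mulgA (gen y * gen y)%g); congr (_ * _)%g.
  rewrite e -[in LHS](prednK L0) expgSr {2}/al expg2 !mulgA !mulgK.
  by [].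
by rewrite !positiveM //; apply: positiveX.
Qed.

End MountainPP.

(** * Mountain words that are not potentially positive *)

Section MountainNotPP.

Variables (X : choiceType) (x y : X).
Hypothesis nxy : x != y.
Implicit Types (ps : seq (nat * nat)) (g : freegroup X).
Local Open Scope ring_scope.
Local Notation mword := (mountain_word x y 15).

Lemma mountain_word_not_pp ps n m n' m' :
  (n, m) \in ps -> (n', m') \in ps -> (m' + 13 <= n)%N ->
  ~ potentially_positive (fgclass (mword ps)).
Proof.
move=> ips ips' le [phi bij_phi pos].
have inj_phi := bij_inj bij_phi.
have phi1 := multiplicative1 phi.
have A0 : phi (gen x) != 1%g by rewrite -phi1 (inj_eq inj_phi) fgclass_eq1.
have [c [A [eA A1 lenA]]] := cyclic_reduction A0.
have axP := intpow_axis A1 lenA.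
set al := intpow A in axP; set ell := len A in axP.
have ell_gt0 : (0 < ell)%N by case: axP.
have [B0 eB0] : exists B0 : freegroup X, B0 = (c^-1 * phi (gen y) * c)%g by eexists.
(* Conjugation by [al k] preserves the axis and brings the projection of [B0] to within one period
   of 0, up to the error of [proj_off]. This gives [prB]. *)
pose k := (proj al ell B0 %/ (2 * ell%:Z))%Z.
have [d ed] : exists d : freegroup X, d = (c * al k)%g by eexists.
pose psi g : freegroup X := (d^-1 * phi g * d)%g.
have psiM : {morph psi : g h / (g * h)%g}.
  by move=> g h; rewrite /psi gmulfM !mulgA mulgK.
have psi_inj : injective psi by move=> g h /mulIg /mulgI /inj_phi.
have psiX g m0 : psi (intpow g m0) = intpow (psi g) m0 by exact: gmul_intpow.
have psi1 : psi 1%g = 1%g by rewrite /psi phi1 mulg1 mulVg.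
have psiV g : psi g^-1%g = (psi g)^-1%g.
  by apply/esym/mulg1_eq; rewrite -psiM mulgV.
have psix : psi (gen x) = al 1.
  rewrite /psi eA ed invgM !mulgA mulgVK mulgVK -(axisN axP) -[X in (_ * X * _)%g]/(al 1).
  by rewrite -!(axisD axP); congr al; lia.
have psixX s : psi (intpow (gen x) s) = al s by rewrite psiX psix.
(* Being off the axis is an inequation between group elements, which the injective [psi]
   preserves. *)
have off g : (forall s : int, `|s|%N = 1%N ->
    (g * intpow (gen x) s * g^-1)%g <> gen x) -> off_axis al (psi g).
  move=> offg s s1 e; apply: (offg s s1); apply: psi_inj.
  by rewrite !psiM psixX psiV e psix.
have [B eB] : exists B, B = psi (gen y) by eexists.
have offB : off_axis al B by rewrite eB; apply: off => s s1; apply: off_gen.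
have offBB s : off_axis al (B * al s * B)%g.
  by rewrite eB -psixX -!psiM; apply: off => t t1; apply: off_pass.
have offVV s : off_axis al (B^-1 * al s * B^-1)%g.
  by rewrite eB -psixX -psiV -!psiM -genV; apply: off => t t1; apply: off_pass.
have offB0 : off_axis al B0.
  move=> s s1 e; apply: (offB s s1).
  have -> : B = (al (- k) * B0 * al k)%g.
    by rewrite eB /psi ed invgM -(axisN axP) eB0 !mulgA.
  rewrite !invgM -!(axisN axP) opprK.
  have -> : (al (- k) * B0 * al k * al s * (al (- k) * (B0^-1 * al k)) =
     al (- k) * (B0 * al s * B0^-1) * al k)%g.
    rewrite -!mulgA; congr (_ * (_ * _))%g; rewrite !mulgA -!(axisD axP).
    by congr (_ * _ * _)%g; congr al; lia.
  by rewrite e -!(axisD axP); congr al; lia.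
have prB : `|proj al ell B| <= 10 * ell%:Z.
  have -> : B = (al (- k) * (B0 * al k))%g.
    by rewrite eB /psi ed invgM -(axisN axP) eB0 !mulgA.
  rewrite (proj_shift axP); have := proj_off axP k offB0.
  have e2 : 2 * ell%:Z != 0 :> int by lia.
  have := divz_eq (proj al ell B0) (2 * ell%:Z); have := ltz_mod (proj al ell B0) e2.
  have := modz_ge0 (proj al ell B0) e2; rewrite -/k; lia.
pose W : freegroup X := (al 15 * mountains al B 15 (mountain_exps ps))%g.
have psi_mountains L qs :
    psi (mountains (intpow (gen x)) (gen y) L qs) = mountains al B L qs.
  elim: qs => // [[u v] qs] IHqs; rewrite [mountains _ _ _ _]/= !psiM !psiV.
  by rewrite IHqs !psixX -eB.
have psiW : psi (fgclass (mword ps)) = W.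
  by rewrite fgclass_mountain_word psiM psixX psi_mountains.
(* [W] is cyclically reduced and conjugate to the positive image under [phi]. *)
have posW : deg W = (len W)%:Z.
  apply: (@positive_conj _ W d^-1%g).
    exact: (len_word_sqr axP offB offBB offVV prB).
  by rewrite -psiW /psi invgK !mulgA mulgV mul1g mulgK.
apply: (mountains_not_positive axP offB offBB offVV prB _ _ _ posW).
- by apply/mapP; exists (n, m).
- by apply/mapP; exists (n', m').
- by move: le => /=; lia.
Qed.

End MountainNotPP.

(** * Derivations and contexts *)

Section Templates.

Variables S T : eqType.

Section Fill.
Variables (V : finType) (e : S -> T) (h : V -> seq T).

(** With [e = id] this substitutes strings; with [e = inl] it composes templates, keeping the
    letters as constants. *)
Definition fill (t : seq (S + V)) : seq T :=
  flatten [seq match c with inl a => [:: e a] | inr v => h v end | c <- t].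

Lemma fill_flatten ts : flatten [seq fill t | t <- ts] = fill (flatten ts).
Proof. by elim: ts => //= t ts ->; rewrite /fill map_cat flatten_cat. Qed.

Definition linear_tmpl (t : seq (S + V)) : Prop :=
  forall v : V, count_mem (inr v) t = 1.

Lemma additive_fill (f : seq T -> nat) t :
    f [::] = 0 -> (forall u v, f (u ++ v) = f u + f v) -> linear_tmpl t ->
  f (fill t) = f (fill [seq c <- t | if c is inl _ then true else false])
             + \sum_v f (h v).
Proof.
move=> f0 fD lin; have f1D a u : f (a :: u) = f [:: a] + f u by rewrite -fD.
have -> : \sum_v f (h v) = \sum_v count_mem (inr v) t * f (h v).
  by apply: eq_bigr => v _; rewrite lin mul1n.
elim: t {lin} => [|[a|w] t IHt] /=.
- by rewrite big1 // f0.
- by rewrite /fill /= (f1D _ (flatten _)) [in RHS]f1D -!/(fill _) IHt addnA.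
rewrite /fill /= fD -/(fill _) IHt addnCA; congr (_ + _).
rewrite [in RHS](bigD1 w) //= [in LHS](bigD1 w) //= eqxx mulnDl mul1n.
rewrite -addnA; congr (_ + (_ + _)); apply: eq_bigr => v nvw.
by rewrite (_ : inr w == inr v = false) //; apply/eqP => -[e1]; rewrite e1 eqxx in nvw.
Qed.

End Fill.

End Templates.

Lemma fill_fill (S T : eqType) (V V' : finType) (h : V' -> seq T) (e : S -> T)
    (h' : V -> seq (S + V')) t :
  fill e h (fill inl h' t) = fill e (fun v => fill e h (h' v)) t.
Proof.
elim: t => //= c t IHt; rewrite /fill /= map_cat flatten_cat -/(fill e h _).
rewrite -!/(fill _ _ _) IHt; congr (_ ++ _).
by case: c => //= a; rewrite /fill /= cats0.
Qed.

Lemma eq_fill (S T : eqType) (V : finType) (e : S -> T) (h h' : V -> seq T) t :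
  h =1 h' -> fill e h t = fill e h' t.
Proof. by move=> eh; congr flatten; apply: eq_map => -[a|v]. Qed.

Section Contexts.

Variables (Sigma : eqType) (G : mcfg Sigma).
Hypothesis wnG : well_nested G.
Implicit Types A B C : nonterm G.

Local Notation fact A := ((dim A).-tuple (seq Sigma)).

(** The index is the number of rule applications, the measure that decreases when a pump is
    removed. *)
Inductive sized : nat -> forall A, fact A -> Prop :=
  Sized (k : rule_index G) (s : 'I_(arity (rules k)) -> nat)
    (u : forall i : 'I_(arity (rules k)), fact (rhs i)) :
    (forall i, sized (s i) (u i)) ->
    sized (\sum_i s i).+1 (map_tuple (subst u) (tmpl (rules k))).

Lemma derivable_sized A (t : fact A) : derivable t -> exists n, sized n t.
Proof.
elim=> k u _ IH.
have [s sP] := fin_all_exists IH.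
by exists (\sum_i s i).+1; apply: Sized.
Qed.

Lemma sized_derivable n A (t : fact A) : sized n t -> derivable t.
Proof. by elim=> k s u _ IH; apply: Derivable. Qed.

(** What a derivation with a hole for a fact of [B] computes; the variables are the components of
    the missing fact. *)
Definition context A B := (dim A).-tuple (seq (Sigma + 'I_(dim B))).

Definition plug A B (F : context A B) (y : fact B) : fact A :=
  map_tuple (fill id (tnth y)) F.

Lemma flatten_plug A B (F : context A B) y :
  flatten (plug F y) = fill id (tnth y) (flatten F).
Proof. exact: fill_flatten. Qed.

(* In a derivation of size n of t, a derivation of size m of y may be replaced
   by any other one. *)
Definition occurs n A (t : fact A) m B (y : fact B) : Prop :=
  [/\ sized m y, m <= n & exists F : context A B,
      [/\ linear_tmpl (flatten F), t = plug F y
        & forall m' y', sized m' y' ->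
            exists2 n', sized n' (plug F y') & n' + m = n + m']].

Lemma occurs_refl n A (t : fact A) : sized n t -> occurs n t n t.
Proof.
move=> st; split=> //; exists [tuple [:: inr i] | i < dim A]; split.
- move=> v; rewrite /= count_flatten -map_comp.
  rewrite (eq_map (g := fun i => (i == v) : nat)); last by move=> i /=; rewrite addn0.
  rewrite sumnE big_map big_enum /= (bigD1 v) //= eqxx big1 ?addn0 // => i.
  by case: eqP.
- apply: eq_from_tnth => i; rewrite tnth_map tnth_mktuple.
  by rewrite /fill /= cats0.
move=> m' y' sy'; exists m'; last by rewrite addnC.
suff -> : plug [tuple [:: inr i] | i < dim A] y' = y' by [].
by apply: eq_from_tnth => i; rewrite tnth_map tnth_mktuple /fill /= cats0.
Qed.

Lemma linear_rule_tmpl (k : rule_index G) :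
  linear_tmpl (V := {i : 'I_(arity (rules k)) & 'I_(dim (rhs i))})
    (flatten (tmpl (rules k))).
Proof.
move=> v; have [once _ _] := wnG k; rewrite -(once v) /var_occs.
by elim: (flatten _) => // -[a|w] t /= ->.
Qed.

Lemma occurs_step (k : rule_index G) s
    (u : forall i : 'I_(arity (rules k)), fact (rhs i)) i m B (y : fact B) :
    (forall j, sized (s j) (u j)) -> occurs (s i) (u i) m y ->
  occurs (\sum_j s j).+1 (map_tuple (subst u) (tmpl (rules k))) m y.
Proof.
move=> su [sy lem [F [linF uF pF]]]; split=> //.
  by apply: leqW; rewrite (bigD1 i) //=; apply: leq_trans lem (leq_addr _ _).
(* The context [F] goes into argument [i]; the other arguments are constant strings, embedded by
   [inl]. *)
pose U := dfwith (fun j => map_tuple (map inl) (u j) : context (rhs j) B) F.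
pose h (v : {j : 'I_(arity (rules k)) & 'I_(dim (rhs j))}) :=
  tnth (U (tag v)) (tagged v).
have plugU y' : plug (map_tuple (fill inl h) (tmpl (rules k))) y'
    = map_tuple (subst (dfwith u (plug F y'))) (tmpl (rules k)).
  apply: eq_from_tnth => l; rewrite !tnth_map fill_fill.
  apply: eq_fill => -[j l'] /=; rewrite /h /U /=.
  case: dfwithP l' => [l'|j' nji l']; first by rewrite dfwith_in tnth_map.
  rewrite dfwith_out // tnth_map; elim: (tnth _ _) => //= a w {2}<-.
  by [].
exists (map_tuple (fill inl h) (tmpl (rules k))); split.
- move=> v; rewrite [X in flatten X]/= fill_flatten additive_fill //; first last.
  + exact: linear_rule_tmpl.
  + by move=> *; rewrite count_cat.
  rewrite (_ : count_mem _ (fill _ _ _) = 0); last first.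
    by elim: (flatten _) => // -[a|w] t IHt //=.
  rewrite add0n; have -> : \sum_p count_mem (inr v) (h p)
      = \sum_j \sum_l count_mem (inr v) (tnth (U j) l).
    by rewrite sig_big_dep.
  have cnt j : \sum_l count_mem (inr v) (tnth (U j) l)
             = count_mem (inr v) (flatten (U j)).
    by rewrite count_flatten sumnE big_map big_tuple.
  rewrite (eq_bigr _ (fun j _ => cnt j)) (bigD1 i) //= big1 => [|j nji].
    by rewrite /U dfwith_in linF.
  rewrite /U dfwith_out 1?eq_sym //= -map_flatten count_map.
  by apply/eqP; rewrite eqn0Ngt -has_count; apply/hasPn.
- rewrite plugU -uF; apply: eq_from_tnth => l; rewrite !tnth_map.
  by apply: eq_fill => -[j l'] /=; case: dfwithP l'.
move=> m' y' /pF[n' sn' en].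
exists (\sum_j (if j == i then n' else s j)).+1.
  rewrite plugU; apply: Sized => j; case: dfwithP => [|j' nji].
    by rewrite eqxx.
  by rewrite eq_sym (negPf nji).
rewrite (bigD1 i) //= eqxx [in RHS](bigD1 i) //=.
rewrite (eq_bigr s) => [|j /negPf-> //]; lia.
Qed.

End Contexts.

(** * Repeated types along the branches of a derivation *)

Section Irredundant.

Variables (Sigma : eqType) (G : mcfg Sigma) (M : finType) (mu : seq Sigma -> M).
Hypothesis wnG : well_nested G.
Implicit Types A B C : nonterm G.

Local Notation fact A := ((dim A).-tuple (seq Sigma)).

Definition fact_type A (t : fact A) : {B : nonterm G & (dim B).-tuple M} :=
  Tagged (fun B => (dim B).-tuple M) (map_tuple mu t).

(* No type is repeated along a branch of the derivation, nor belongs to seen. *)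
Inductive irredundant (seen : seq {B : nonterm G & (dim B).-tuple M}) :
    forall A, fact A -> Prop :=
  Irredundant (k : rule_index G)
    (u : forall i : 'I_(arity (rules k)), fact (rhs i)) :
    fact_type (map_tuple (subst u) (tmpl (rules k))) \notin seen ->
    (forall i, irredundant
       (fact_type (map_tuple (subst u) (tmpl (rules k))) :: seen) (u i)) ->
    irredundant seen (map_tuple (subst u) (tmpl (rules k))).

Definition pumpable n A (t : fact A) : Prop :=
  exists n1 B (t1 t2 : fact B) n2,
    [/\ occurs n t n1 t1, occurs n1 t1 n2 t2, n2 < n1
      & map mu t1 = map mu t2].

Lemma eq_fact_type B C (t1 : fact B) (t2 : fact C) :
  fact_type t1 = fact_type t2 ->
  exists e : C = B, map mu t1 = map mu (ecast D (fact D) e t2).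
Proof.
move=> e; have eBC : C = B by move: (congr1 tag e).
exists eBC; case: _ / eBC t1 e => t1 /eqP.
by rewrite /fact_type eq_Tagged /= => /eqP /(congr1 val).
Qed.

(** [seen] stands for the types of the ancestors. A repetition reported by an argument either
    concerns the current fact, which makes it pumpable, or is passed on to an ancestor. *)
Lemma irredundant_or_pumpable n A (t : fact A) : sized n t -> forall seen,
  [\/ irredundant seen t,
      exists m B (y : fact B), occurs n t m y /\ fact_type y \in seen
    | pumpable n t].
Proof.
elim=> k s u su IH seen; set t' := map_tuple _ _.
have st' : sized (\sum_i s i).+1 t' by apply: Sized.
have [ts|nts] := boolP (fact_type t' \in seen).
  by apply: Or32; exists (\sum_i s i).+1, (lhs (rules k)), t'; split=> //;
    apply: occurs_refl.
have [ir|/not_all_ex_not[i nir]] :=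
  classic (forall i, irredundant (fact_type t' :: seen) (u i)).
  by apply: Or31; apply: Irredundant.
have [//|[m [B [y [oy yin]]]]|[n1 [B [t1 [t2 [n2 [o1 o2 lt e]]]]]]] :=
  IH i (fact_type t' :: seen); last first.
  by apply: Or33; exists n1, B, t1, t2, n2; split=> //; apply: (occurs_step wnG su o1).
have oy' := occurs_step wnG su oy.
move: yin; rewrite inE => /predU1P[/esym e|yin]; last by apply: Or32; exists m, B, y.
have [eB e2] := eq_fact_type e.
apply: Or33; exists (\sum_i s i).+1, (lhs (rules k)), t', (ecast D (fact D) eB y), m.
have cast C (eC : B = C) : occurs (\sum_i s i).+1 t' m (ecast D (fact D) eC y).
  by case: _ / eC.
split=> //; first exact: occurs_refl.
have [_ lem _] := oy; rewrite ltnS (bigD1 i) //=.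
exact: leq_trans lem (leq_addr _ _).
Qed.

Definition fact_size A (t : fact A) := size (flatten t).

Lemma subst_size (k : rule_index G)
    (u : forall i : 'I_(arity (rules k)), fact (rhs i)) :
  fact_size (map_tuple (subst u) (tmpl (rules k)))
    <= size (flatten (tmpl (rules k))) + \sum_i fact_size (u i).
Proof.
pose h (v : {j : 'I_(arity (rules k)) & 'I_(dim (rhs j))}) := tnth (u (tag v)) (tagged v).
have -> : fact_size (map_tuple (subst u) (tmpl (rules k)))
        = size (fill id h (flatten (tmpl (rules k)))).
  by rewrite -fill_flatten.
rewrite (@additive_fill _ _ _ _ _ size) //; last 2 first.
- by move=> *; rewrite size_cat.
- exact: linear_rule_tmpl.
apply: leq_add; first by elim: (flatten _) => // -[a|v] t /= IH //; apply: leqW.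
have -> : \sum_p size (h p) = \sum_j \sum_l size (tnth (u j) l) by rewrite sig_big_dep.
apply: leq_sum => j _; rewrite /fact_size size_flatten sumnE big_map big_tuple.
exact: leqnn.
Qed.

(** [k] counts the types still available and thus bounds the height of the derivation; each level
    multiplies the bound by an arity and adds the length of a template. *)
Lemma irredundant_bound k : exists b, forall seen A (t : fact A),
  uniq seen -> #|{: {B : nonterm G & (dim B).-tuple M}}| <= size seen + k ->
  irredundant seen t -> fact_size t <= b.
Proof.
elim: k => [|k [b IHb]].
  exists 0 => seen A t us; rewrite addn0 => le ir; case: ir => r u nin _.
  set x := fact_type _ in nin; have /card_uniqP e : uniq (x :: seen) by rewrite /= nin.
  have : size (x :: seen) <= size seen by rewrite -e; apply: leq_trans (max_card _) le.
  by rewrite ltnn.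
exists (\max_(r : rule_index G) (size (flatten (tmpl (rules r))) + arity (rules r) * b)).
move=> seen A t us le ir; case: ir => r u nin ir.
apply: leq_trans (leq_bigmax r); apply: leq_trans (subst_size _) _.
rewrite leq_add2l; apply: (@leq_trans (\sum_(i < arity (rules r)) b)); last first.
  by rewrite sum_nat_const card_ord.
apply: leq_sum => i _.
apply: IHb (ir i); first by rewrite /= nin.
by rewrite /= addSnnS.
Qed.

End Irredundant.

(** * Defects and pumping *)

Section Defect.

Variables (Sigma : eqType) (isb : pred Sigma) (c : nat).
Implicit Types (u w : seq Sigma).

(* The number of separators whose distance to the previous one exceeds c,
   when the last separator before u is at distance k. *)
Fixpoint defect k u : nat :=
  if u is x :: u' then
    if isb x then (c < k) + defect 0 u' else defect k.+1 u'
  else 0.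

Local Notation dft := (defect c.+1).

Lemma defect_mono k k' u : (k <= k') || (c < k') -> defect k u <= defect k' u.
Proof.
elim: u k k' => //= x u IHu k k' le; case: ifP => _.
  by rewrite leq_add2r; lia.
by apply: IHu; lia.
Qed.

Lemma defect_far k u : defect k u <= dft u.
Proof. by apply: defect_mono; rewrite ltnSn orbT. Qed.

(** Starting from [c.+1], as if the previous separator were far away, gives the largest defect, so
    [dft w] covers every way in which [u] can end. *)
Lemma defect_cat k u w : defect k (u ++ w) <= defect k u + dft w.
Proof.
elim: u k => [|x u IHu] k /=; first exact: defect_far.
by case: ifP => _; rewrite ?IHu // -addnA leq_add2l.
Qed.

Lemma defect_near k u : k + size u <= c.+1 -> defect k u = 0.
Proof.
elim: u k => //= x u IHu k le; case: ifP => _; last by apply: IHu; lia.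
by rewrite IHu; [case: ltnP => //; lia | lia].
Qed.

Lemma defect_short u : size u <= c -> dft u <= 1.
Proof.
suff: forall k, size u <= c.+1 -> defect k u <= 1 by move=> H ?; apply: H; lia.
elim: u => //= x u IHu k le; case: ifP => _; last by apply: IHu; lia.
by rewrite (@defect_near 0); [case: ltnP | lia].
Qed.

Variable V : finType.
Implicit Types (t : seq (Sigma + V)) (h : V -> seq Sigma).

Definition consts t : seq Sigma := pmap (fun x => if x is inl a then Some a else None) t.

Definition var_sum (g : V -> nat) t : nat :=
  \sum_(x <- t) (if x is inr v then g v else 0).

Lemma var_sum_linear g t : linear_tmpl t -> var_sum g t = \sum_v g v.
Proof.
move=> lin; have -> : \sum_v g v = \sum_v count_mem (inr v) t * g v.
  by apply: eq_bigr => v _; rewrite lin mul1n.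
rewrite /var_sum; elim: t {lin} => [|[a|w] t IHt] /=.
- by rewrite big_nil big1.
- by rewrite big_cons IHt.
rewrite big_cons IHt [in RHS](bigD1 w) //= [in LHS](bigD1 w) //= eqxx mulnDl mul1n.
rewrite -addnA; congr (_ + (_ + _)); apply: eq_bigr => v nvw.
by rewrite (_ : inr w == inr v = false) //; apply/eqP => -[e1]; rewrite e1 eqxx in nvw.
Qed.

(** A constant that is no separator has [dft] 0, so a context without separators can be iterated
    without increasing the total defect. *)
Lemma defect_fill_no_sep h t : ~~ has isb (consts t) ->
  dft (fill id h t) <= var_sum (fun v => dft (h v)) t.
Proof.
elim: t => //= x t IHt nb; rewrite /fill /= -/(fill id h t).
rewrite /var_sum big_cons -/(var_sum _ t); apply: leq_trans (defect_cat _ _ _) _.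
case: x nb => [a|v] /=; last by move=> nb; rewrite leq_add2l IHt.
by rewrite negb_or => /andP[/negPf-> nb]; rewrite !add0n; apply: IHt.
Qed.

Lemma defect_fill h t : size t <= c ->
  dft (fill id h t) <= 1 + var_sum (fun v => (dft (h v)).+1) t.
Proof.
rewrite -[fill id h t]cat0s -[size t]/(size (nil : seq Sigma) + size t).
(* [u] is the run of constants read since the last variable; its length stays at most [c], so it
   adds at most 1. *)
elim: t [::] => [|x t IHt] u le.
  by rewrite cats0 /var_sum big_nil; apply: defect_short; move: le => /=; lia.
rewrite /var_sum big_cons -/(var_sum _ t) /fill /= -/(fill id h t).
case: x le => [a|v] le /=.
  rewrite -cat_rcons; apply: IHt; move: le; rewrite size_rcons /=; lia.
have h1 := defect_cat c.+1 u (h v ++ fill id h t).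
have h2 := defect_cat c.+1 (h v) (fill id h t).
have h3 : dft u <= 1 by apply: defect_short; move: le => /=; lia.
have := IHt [::]; rewrite cat0s /=; move: le => /=; lia.
Qed.

Lemma additive_consts (f : seq Sigma -> nat) h t :
    f [::] = 0 -> (forall u v, f (u ++ v) = f u + f v) -> linear_tmpl t ->
  f (fill id h t) = f (consts t) + \sum_v f (h v).
Proof.
move=> f0 fD lin; rewrite (additive_fill _ _ f0 fD lin); congr (f _ + _).
by elim: t {lin} => // -[a|v] t /= <-.
Qed.

End Defect.

Section Pumping.

Variables (Sigma : eqType) (G : mcfg Sigma).
Hypothesis wnG : well_nested G.
Implicit Types A B C : nonterm G.

Local Notation fact A := ((dim A).-tuple (seq Sigma)).

Lemma additive_plug (f : seq Sigma -> nat) A B (F : context A B) (y : fact B) :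
    f [::] = 0 -> (forall u v, f (u ++ v) = f u + f v) -> linear_tmpl (flatten F) ->
  f (flatten (plug F y)) = f (consts (flatten F)) + f (flatten y).
Proof.
move=> f0 fD lin; rewrite flatten_plug additive_consts //; congr (_ + _).
have -> : f (flatten y) = \sum_(t <- y) f t.
  by elim: (tval y) => [|t s IHs]; rewrite ?big_nil // big_cons -IHs -fD.
by rewrite big_tuple.
Qed.

Lemma additive_iter_plug (f : seq Sigma -> nat) B (F : context B B) (y : fact B) p :
    f [::] = 0 -> (forall u v, f (u ++ v) = f u + f v) -> linear_tmpl (flatten F) ->
  f (flatten (iter p (plug F) y)) = p * f (consts (flatten F)) + f (flatten y).
Proof.
move=> f0 fD lin; elim: p => //= p IHp.
by rewrite additive_plug // IHp mulSn addnA.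
Qed.

Lemma defect_iter_plug (isb : pred Sigma) c B (F : context B B) (y : fact B) p :
    linear_tmpl (flatten F) -> ~~ has isb (consts (flatten F)) ->
    size (flatten y) <= c ->
  \sum_i defect isb c c.+1 (tnth (iter p (plug F) y) i) <= dim B.
Proof.
move=> lin nb szy; elim: p => [|p IHp].
  rewrite -[X in _ <= X]card_ord -sum1_card; apply: leq_sum => i _.
  apply: defect_short; apply: leq_trans szy; rewrite size_flatten sumnE big_map.
  by rewrite big_tuple (bigD1 i) //= leq_addr.
apply: leq_trans IHp; set y' := iter p _ _; rewrite -[X in _ <= X](var_sum_linear _ lin).
rewrite /var_sum big_flatten /= [X in _ <= X]big_tuple; apply: leq_sum => i _.
rewrite tnth_map; apply: defect_fill_no_sep; apply: contra nb => /hasP[x xin bx].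
apply/hasP; exists x => //; move: xin; rewrite /consts !mem_pmap.
case/mapP=> z zin ez; apply/mapP; exists z => //.
by apply/flattenP; exists (tnth F i) => //; apply: mem_tnth.
Qed.

(** The components of the iterated fact have total defect at most [dim B], and each of the
    [dim B + 1] runs of constants of [F0] adds at most 1. The bound is independent of [p]. *)
Lemma defect_pump (isb : pred Sigma) c A B (F0 : context A B) (F : context B B)
    (y : fact B) p :
    linear_tmpl (flatten F0) -> linear_tmpl (flatten F) ->
    ~~ has isb (consts (flatten F)) ->
    size (flatten y) <= c -> size (flatten F0) <= c ->
  defect isb c c.+1 (flatten (plug F0 (iter p (plug F) y))) <= 1 + (dim B).*2.
Proof.
move=> lin0 lin nb szy szF; rewrite flatten_plug.
apply: leq_trans (defect_fill _ _ szF) _; rewrite leq_add2l var_sum_linear //.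
rewrite (eq_bigr (fun i => 1 + defect isb c c.+1 (tnth (iter p (plug F) y) i))) //.
rewrite big_split /= sum1_card card_ord -addnn leq_add2l.
exact: defect_iter_plug.
Qed.

End Pumping.

(** * Automata for patterns *)

Section Patterns.

Variable T : choiceType.
Implicit Types (x y z : T) (p q : seq (T * bool)) (u v w : seq T).

(* The item (x, false) stands for the letter x, (x, true) for x^*. *)
Fixpoint matches p u : Prop :=
  match p with
  | [::] => u = [::]
  | (x, false) :: p' => exists2 v, u = x :: v & matches p' v
  | (x, true) :: p' => exists k v, u = nseq k x ++ v /\ matches p' v
  end.

(** A deterministic automaton whose states are the remaining patterns, [None] being failure. It
    leaves a star only by reading the single letter that follows, which must differ from the starred
    one; mountain patterns have this form. *)
Definition pstep (s : option (seq (T * bool))) x : option (seq (T * bool)) :=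
  match s with
  | Some ((y, false) :: p) => if x == y then Some p else None
  | Some ((y, true) :: p) =>
      if x == y then Some ((y, true) :: p)
      else if p is (z, false) :: p' then if x == z then Some p' else None else None
  | _ => None
  end.

Definition prun := foldl pstep.

Lemma prun_None u : prun None u = None.
Proof. by elim: u. Qed.

Lemma prun_matches p u : prun (Some p) u = Some [::] -> matches p u.
Proof.
elim: u p => [|x u IHu] [|[y []] p] //=; rewrite /prun /= -/prun ?prun_None //.
  case: eqP => [->|_].
    by move=> /IHu /= [k [v [-> mv]]]; exists k.+1, v.
  case: p => [|[z []] p]; rewrite -/(prun _ u) ?prun_None //.
  case: eqP => [->|_]; last by rewrite prun_None.
  by move=> /IHu m; exists 0, (z :: u); split=> //; exists u.
case: eqP => [->|_]; last by rewrite -/(prun _ u) prun_None.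
by move=> /IHu m; exists u.
Qed.

Lemma prun_letter x p u : prun (Some ((x, false) :: p)) (x :: u) = prun (Some p) u.
Proof. by rewrite /prun /= eqxx. Qed.

Lemma prun_star x z p k u : x != z ->
  prun (Some [:: (x, true), (z, false) & p]) (nseq k x ++ z :: u) = prun (Some p) u.
Proof.
move=> nxz; elim: k => [|k IHk]; rewrite /prun /=; last by rewrite eqxx; apply: IHk.
by rewrite eq_sym (negPf nxz) eqxx.
Qed.

Lemma prun_nseq n x p u :
  prun (Some (nseq n (x, false) ++ p)) (nseq n x ++ u) = prun (Some p) u.
Proof. by elim: n => // n IHn; rewrite /prun /= eqxx; apply: IHn. Qed.

Lemma matches_nseq n x p u : matches (nseq n (x, false) ++ p) u ->
  exists2 v, u = nseq n x ++ v & matches p v.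
Proof.
elim: n u => [|n IHn] u /=; first by exists u.
by case=> v -> /IHn[w -> m]; exists w.
Qed.

Variable pat : seq (T * bool).

Definition pstates : seq (option (seq (T * bool))) :=
  None :: [seq Some (drop i pat) | i <- iota 0 (size pat).+1].

Lemma pstatesP s : reflect (s = None \/ exists i, s = Some (drop i pat)) (s \in pstates).
Proof.
apply: (iffP idP); rewrite inE.
  by case/predU1P=> [->|/mapP[i _ ->]]; [left | right; exists i].
case=> [->|[i ->]]; rewrite ?eqxx //; apply/mapP.
have [le|lt] := leqP i (size pat); first by exists i; rewrite // mem_iota ltnS.
by exists (size pat); [rewrite mem_iota ltnS leqnn |
  rewrite drop_size drop_oversize // ltnW].
Qed.

Lemma pstep_states s x : s \in pstates -> pstep s x \in pstates.
Proof.
have none : None \in pstates by rewrite inE eqxx.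
case/pstatesP=> [->//|[i ->]] /=; case e : (drop i pat) => [|[y []] p] //=.
  case: eqP => _; first by apply/pstatesP; right; exists i; rewrite e.
  case: p e => [|[z []] p] // e; case: eqP => // _.
  by apply/pstatesP; right; exists i.+2; rewrite -add2n -drop_drop e /= drop0.
case: eqP => // _; apply/pstatesP; right; exists i.+1.
by rewrite -add1n -drop_drop e /= drop0.
Qed.

Lemma prun_states s u : s \in pstates -> prun s u \in pstates.
Proof. by elim: u s => //= x u IHu s sin; apply: IHu; apply: pstep_states. Qed.

(** The states are failure and the finitely many suffixes of [pat], so this type is finite and can
    label facts. *)
Definition pmonoid := {ffun seq_sub pstates -> seq_sub pstates}.

Definition transition u : pmonoid := [ffun s => insubd s (prun (ssval s) u)].

Lemma transitionE u v : transition u = transition v <->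
  (forall s, s \in pstates -> prun s u = prun s v).
Proof.
split=> [e s sin|e]; last by apply/ffunP => s; rewrite !ffunE e // ssvalP.
move/ffunP: e => /(_ (SeqSub sin)); rewrite !ffunE => /(congr1 val).
by rewrite !insubdK //=; apply: prun_states.
Qed.

Lemma transition_cat u u' v v' : transition u = transition u' ->
  transition v = transition v' -> transition (u ++ v) = transition (u' ++ v').
Proof.
move=> /transitionE eu /transitionE ev; apply/transitionE => s sin.
by rewrite /prun !foldl_cat -!/(prun _ _) eu // ev // prun_states.
Qed.

(** Equality of transitions is a congruence by [transition_cat]; so a hole can be refilled without
    changing the behaviour of the automaton. *)
Lemma transition_fill (V : finType) (h h' : V -> seq T) (t : seq (T + V)) :
  (forall i, transition (h i) = transition (h' i)) ->
  transition (fill id h t) = transition (fill id h' t).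
Proof.
by move=> e; elim: t => //= -[a|v] t IHt; apply: transition_cat.
Qed.

Lemma prun_transition u v : transition u = transition v ->
  prun (Some pat) u = prun (Some pat) v.
Proof. by move/transitionE; apply; apply/pstatesP; right; exists 0; rewrite drop0. Qed.

End Patterns.

(** * The grammar of mountain words *)

Section MountainShape.

Variables (X : choiceType) (x y : X) (L : nat).
Hypothesis nxy : x != y.
Implicit Types (ps : seq (nat * nat)) (u v : seq (letter X)).

Local Notation a := (x, false).
Local Notation a' := (x, true).
Local Notation b := (y, false).
Local Notation b' := (y, true).
Local Notation mword := (mountain_word x y L).

Definition mountain_item : seq (letter X * bool) :=
  [:: (b, false), (a', true), (b, false) & nseq L (a, false) ++
   [:: (b', false), (a, true), (b', false) & nseq L (a, false)]].

Definition mountain_pattern K := nseq L (a, false) ++ flatten (nseq K mountain_item).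

Lemma prun_mountain_word ps :
  prun (Some (mountain_pattern (size ps))) (mword ps) = Some [::].
Proof.
rewrite prun_nseq; elim: ps => // -[n m] ps IHps.
rewrite -[flatten [seq _ | _ <- _]]/(mountain x y L (n, m) ++
    flatten [seq mountain x y L p | p <- ps]).
rewrite -[flatten (nseq _ _)]/(mountain_item ++ flatten (nseq (size ps) mountain_item)).
rewrite /mountain /mountain_item ?cat_cons -?catA ?cat_cons -?catA ?cat_cons -?catA.
rewrite ?cat_cons -?catA prun_letter prun_star ?prun_nseq; last first.
  by rewrite xpair_eqE (negPf nxy).
by rewrite prun_letter prun_star ?prun_nseq // xpair_eqE (negPf nxy).
Qed.

Lemma matches_mountain_pattern K u : matches (mountain_pattern K) u ->
  exists2 ps, size ps = K & u = mword ps.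
Proof.
case/matches_nseq => v -> m; rewrite /mountain_word.
suff [ps sps ->] : exists2 ps, size ps = K & v = flatten [seq mountain x y L p | p <- ps].
  by exists ps.
elim: K v m => [|K IHK] v; first by move=> ->; exists [::].
rewrite -[flatten (nseq _ _)]/(mountain_item ++ flatten (nseq K mountain_item)).
rewrite /mountain_item ?cat_cons -?catA ?cat_cons.
case=> v1 -> [n [v2 [-> [v3 -> /matches_nseq[v4 -> [v5 -> [m [v6 [-> [v7 -> ]]]]]]]]]].
case/matches_nseq=> v8 -> /IHK[ps sps ->]; exists ((n, m) :: ps); first by rewrite /= sps.
by rewrite /= /mountain /= -?catA /= -?catA /= -?catA.
Qed.

Definition is_sep (l : letter X) : bool := l.1 == y.

Lemma count_sep ps : count is_sep (mword ps) = 4 * size ps.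
Proof.
rewrite count_cat count_nseq /is_sep /= (negPf nxy) mul0n add0n.
elim: ps => // -[n m] ps IHps; rewrite /= count_cat IHps.
rewrite !(count_cat, count_nseq) /= !(count_cat, count_nseq) /= !(count_cat, count_nseq) /=.
by rewrite !(count_cat, count_nseq) /= (negPf nxy) eqxx; lia.
Qed.

Lemma count_inv ps : count (pred1 a') (mword ps) = \sum_(p <- ps) p.1.
Proof.
have e1 : (a == a') = false by rewrite xpair_eqE andbF.
have e2 : (b == a') = false by rewrite xpair_eqE andbF.
have e3 : (b' == a') = false by rewrite xpair_eqE eq_sym (negPf nxy).
rewrite count_cat count_nseq /= e1 mul0n add0n.
elim: ps => [|[n m] ps IHps]; first by rewrite big_nil.
rewrite big_cons /= count_cat IHps.
rewrite !(count_cat, count_nseq) /= !(count_cat, count_nseq) /= !(count_cat, count_nseq) /=.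
by rewrite !(count_cat, count_nseq) /= e1 e2 e3 eqxx; lia.
Qed.

Lemma defect_nseq c k n (z : letter X) u : ~~ is_sep z ->
  defect is_sep c k (nseq n z ++ u) = defect is_sep c (k + n) u.
Proof.
move=> /negPf nz; elim: n k => [|n IHn] k; first by rewrite addn0.
by rewrite /= nz IHn addnS.
Qed.

(** In each factor the second [b'] lies [p.2] letters after the first, hence counts as far. *)
Lemma defect_mountain_word c ps : all (fun p => c < p.2) ps ->
  size ps <= defect is_sep c c.+1 (mword ps).
Proof.
have sa s : ~~ is_sep (x, s) by rewrite /is_sep /= nxy.
have sb s : is_sep (y, s) by rewrite /is_sep /= eqxx.
move=> aps; rewrite /mountain_word defect_nseq //.
elim: ps (c.+1 + L) aps => // -[n m] ps IHps k /= /andP[ltcm /IHps IH].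
rewrite sb -?catA /= defect_nseq //= sb -?catA /= defect_nseq //= sb -?catA /=.
rewrite defect_nseq //= sb add0n ltcm defect_nseq //.
have := IH (0 + L); lia.
Qed.

End MountainShape.

(** * Pumping mountain words *)

Section PumpMountains.

Variables (X : choiceType) (x y : X) (G : mcfg (letter X)) (K : nat).
Hypothesis nxy : x != y.
Hypothesis wnG : well_nested G.
Hypothesis gt_dimK : forall A : nonterm G, 1 + (dim A).*2 < K.
Hypothesis lang_pp : forall w, mcfg_lang G w -> potentially_positive (fgclass w).

Local Notation fact A := ((dim A).-tuple (seq (letter X))).
Local Notation pat := (mountain_pattern x y 15 K).
Local Notation mword := (mountain_word x y 15).
Local Notation a' := (x, true).
Local Notation mu := (transition pat).

(** The transitions of [t2] are a fixed point of the action of [F]. *)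
Lemma transition_iter (B : nonterm G) (F : context B B) (t1 t2 : fact B) p :
    t1 = plug F t2 -> (forall i, mu (tnth t1 i) = mu (tnth t2 i)) ->
  forall i, mu (tnth (iter p (plug F) t2) i) = mu (tnth t2 i).
Proof.
move=> e12 e; elim: p => //= p IHp i; rewrite -[RHS]e e12 !tnth_map.
exact: transition_fill.
Qed.

Lemma start_word n (t : fact (start G)) : sized n t -> mcfg_lang G (flatten t).
Proof.
move=> st; exists t; last exact: sized_derivable st.
case: t {st} => s /=; rewrite dim_start.
by case: s => [|w []] //= _; rewrite cats0.
Qed.

Lemma pump_mountains n (t : fact (start G)) :
    sized n t -> prun (Some pat) (flatten t) = Some [::] -> pumpable mu n t ->
  exists n' (t' : fact (start G)),
    [/\ n' < n, sized n' t', prun (Some pat) (flatten t') = Some [::]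
      & count (pred1 a') (flatten t') = count (pred1 a') (flatten t)].
Proof.
move=> st run [n1 [B [t1 [t2 [n2
  [[_ _ [F0 [lin0 et p0]]] [s2 _ [F [lin e1 p1]]] lt emu]]]]]].
have {}emu i : mu (tnth t1 i) = mu (tnth t2 i).
  have e : map_tuple mu t1 = map_tuple mu t2 by apply: val_inj.
  by have := congr1 (fun u => tnth u i) e; rewrite !tnth_map.
have siter p : exists m, sized m (iter p (plug F) t2).
  elim: p => [|p [m sm]]; first by exists n2.
  by have [m' sm' _] := p1 _ _ sm; exists m'.
have slang p : exists m, sized m (plug F0 (iter p (plug F) t2)).
  by have [m /p0[m' sm' _]] := siter p; exists m'.
(* [w 1] is the original word and [w 0] the word without the pump. *)
pose w p := flatten (plug F0 (iter p (plug F) t2)).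
have wmu p : mu (w p) = mu (flatten t).
  rewrite /w et !flatten_plug; apply: transition_fill => i.
  by rewrite emu; apply: transition_iter e1 emu i.
have wshape p : exists2 ps, size ps = K & w p = mword ps.
  by apply/matches_mountain_pattern/prun_matches; rewrite (prun_transition (wmu p)).
have wpp p : potentially_positive (fgclass (w p)).
  by have [m /start_word/lang_pp] := slang p.
have wcount (P : pred (letter X)) p : count P (w p) =
    count P (consts (flatten F0)) +
    (p * count P (consts (flatten F)) + count P (flatten t2)).
  rewrite /w additive_plug ?additive_iter_plug // => *; exact: count_cat.
(* Both [w 0] and [w 1] contain exactly [4 * K] separators. *)
have nosep : ~~ has (is_sep y) (consts (flatten F)).
  have [ps0 sz0 e0] := wshape 0; have [ps sz e] := wshape 1.
  have := wcount (is_sep y) 0; have := wcount (is_sep y) 1.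
  by rewrite e0 e !(count_sep _ nxy) sz sz0 has_count; lia.
have noinv : count (pred1 a') (consts (flatten F)) = 0.
  apply/eqP; rewrite eqn0Ngt; apply/negP => pos.
  (* Large enough for both size conditions of [defect_pump]. *)
  pose c := size (flatten t2) + size (flatten F0).
  (* With one [a'] or more per pump, [K] factors share at least [K * (c + 13)] of them, so one
     factor has at least [c + 13]. *)
  have [ps sz e] := wshape (K * (c + 13)); have pp := wpp (K * (c + 13)).
  (* If all [K] second exponents exceeded [c], the defect would be at least [K], against
     [defect_pump] and [gt_dimK]. *)
  have [q qin qle] : exists2 q, q \in ps & q.2 <= c.
    have [/(defect_mountain_word 15 nxy)|] := boolP (all (fun q => c < q.2) ps).
      have := defect_pump (c := c) (K * (c + 13)) lin0 lin nosep
        (leq_addr _ _) (leq_addl _ _).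
      rewrite -/(w _) e sz => h1 h2.
      by have := leq_trans h2 h1; rewrite leqNgt gt_dimK.
    by case/allPn=> q qin; rewrite -leqNgt; exists q.
  have [q' q'in q'le] : exists2 q', q' \in ps & c + 13 <= q'.1.
    have [/hasP[q' q'in q'le]|/hasPn no] := boolP (has (fun q' => c + 13 <= q'.1) ps).
      by exists q'.
    have := wcount (pred1 a') (K * (c + 13)); rewrite e count_inv //.
    have : \sum_(q <- ps) q.1 + K <= K * (c + 13).
      rewrite -sz mulnC; elim: (ps) no => [|q1 ps' IH] no; first by rewrite big_nil.
      rewrite big_cons /= mulnS; have := no q1 (mem_head _ _).
      have := IH (fun q h => no q (mem_behead (s := q1 :: ps') h)); lia.
    have := leq_pmulr (K * (c + 13)) pos; have := gt_dimK B.
    by move: (K * (c + 13)) (count_mem _ _) => M1 M2; lia.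
  case: q qin qle => n0 m0 qin /= qle; case: q' q'in q'le => n3 m3 q'in /= q'le.
  apply: (mountain_word_not_pp nxy q'in qin (n := n3) (m' := m0)); last by rewrite -e.
  lia.
have [n' sn' en'] := p0 _ _ s2.
exists n', (plug F0 t2); split=> //; first by lia.
  by rewrite -[flatten _]/(w 0) (prun_transition (wmu 0)).
rewrite -[flatten _]/(w 0) (_ : flatten t = w 1) ?wcount ?noinv ?muln0 //.
by rewrite /w et /= -e1.
Qed.

(** Removing a pump shortens the derivation and keeps the number of [a']; a derivation without
    repeated types yields a word of bounded length. *)
Lemma mountains_bounded : exists bd, forall n (t : fact (start G)),
    sized n t -> prun (Some pat) (flatten t) = Some [::] ->
  count (pred1 a') (flatten t) <= bd.
Proof.
have [bd bdP] := irredundant_bound mu wnG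
  #|{: {B : nonterm G & (dim B).-tuple (pmonoid pat)}}|.
exists bd => n; elim/ltn_ind: n => n IH t st run.
have [ir|[m [B [z [_ //]]]]|] := irredundant_or_pumpable mu wnG st [::].
  by apply: leq_trans (count_size _ _) _; apply: bdP ir; rewrite ?add0n.
case/(pump_mountains st run) => n' [t' [ltn' st' run' <-]].
exact: (IH _ ltn').
Qed.

End PumpMountains.

Theorem theorem6p2 (r : nat) (hr : 2 <= r) : ~ well_nested_mcfl (PP r).
Proof.
case=> G wnG PPE; pose x : 'I_r := Ordinal (ltnW hr); pose y : 'I_r := Ordinal hr.
have nxy : x != y by [].
pose D := \max_(A : nonterm G) dim A; pose K := D.*2.+2.
have gt_dimK (A : nonterm G) : 1 + (dim A).*2 < K.
  by rewrite /K add1n !ltnS leq_double; apply: leq_bigmax.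
have lang_pp w : mcfg_lang G w -> potentially_positive (fgclass w) by case/PPE.
have [bd bdP] := mountains_bounded nxy wnG gt_dimK lang_pp.
(* The first factor alone has more than [bd] letters inverse to [x]. *)
pose w := mountain_word x y 15 (nseq K (bd.+1, bd.+1)).
have [t et /derivable_sized[n st]] : mcfg_lang G w.
  apply/PPE; split; first exact: mountain_word_cyclically_reduced.
  exact: mountain_word_pp.
have ft : flatten t = w by rewrite et /= cats0.
have := bdP n t st; rewrite ft -{1}(size_nseq K (bd.+1, bd.+1)) prun_mountain_word //.
move=> /(_ erefl); rewrite count_inv // //.
by rewrite big_cons leqNgt /= ltn_addr.
Qed.
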